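(* Let $A$ be an Artin algebra, $n\ge2$, and let $T_n(A)$ be the algebra of upper triangular $n\times n$ matrices with entries in $A$. (1) A left $T_n(A)$-module $\begin{pmatrix} X_n \\ \vdots \\ X_1 \end{pmatrix}_{(\phi_i)}$ is semi-Gorenstein-projective if and only if the maps $\phi_i^*=\operatorname{Hom}_A(\phi_i,A):\operatorname{Hom}_A(X_{i+1},A)\to\operatorname{Hom}_A(X_i,A)$ are epimorphisms for $1\le i\le n-1$ and $X_i$ is a semi-Gorenstein-projective left $A$-module for all $1\le i\le n$. (2) A left $T_n(A)$-module $\begin{pmatrix} X_n \\ \vdots \\ X_1 \end{pmatrix}_{(\phi_i)}$ is Gorenstein-projective if and only if $X_i$ is a Gorenstein-projective left $A$-module for all $1\le i\le n$, the maps $\phi_i:X_i\to X_{i+1}$ are monomorphisms, and $\operatorname{Coker}\phi_i$ is a Gorenstein-projective left $A$-module for $1\le i\le n-1$. (3) $T_n(A)$ is a left weakly Gorenstein algebra if and only if $A$ is.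
   Context: All modules are finitely generated. A left $T_n(A)$-module is identified with a tuple $\begin{pmatrix} X_n \\ \vdots \\ X_1 \end{pmatrix}_{(\phi_i)}$, where $X_1,\dots,X_n$ are left $A$-modules and $\phi_i:X_i\to X_{i+1}$ are $A$-homomorphisms for $1\le i\le n-1$ (elements are columns with top entry in $X_n$, and $T_n(A)$ acts by matrix multiplication using the $\phi_i$ and their composites). For an Artin algebra $R$: a left $R$-module $Z$ is semi-Gorenstein-projective if $\operatorname{Ext}^i_R(Z,R)=0$ for all $i\ge 1$. A left $R$-module $G$ is Gorenstein-projective if there is an acyclic complex $P^\bullet:\cdots\to P^{-1}\to P^0\xrightarrow{d_0}P^1\to\cdots$ of finitely generated projective left $R$-modules such that $\operatorname{Hom}_R(P^\bullet,P)$ is acyclic for every finitely generated projective $P$, and $G\cong\operatorname{Ker}d_0$. $R$ is left weakly Gorenstein if every semi-Gorenstein-projective left $R$-module is Gorenstein-projective. *)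

(* Defs.v *)
From HB Require Import structures.
From mathcomp Require Import all_boot all_order all_algebra.
From mathcomp Require Import boolp.

Set Implicit Arguments.
Unset Strict Implicit.
Unset Printing Implicit Defensive.

Import GRing.Theory.
Local Open Scope ring_scope.
Local Open Scope quotient_scope.

(* Rings are [pzRingType]s, so that the zero ring is allowed, and modules are
   left modules [lmodType R]; [R^o] is the regular left module of R.
   Linear maps are compared pointwise. *)

Definition surj (U V : Type) (f : U -> V) : Prop := forall v, exists u, f u = v.

Definition fin_gen (R : pzRingType) (M : lmodType R) : Prop :=
  exists (m : nat) (g : 'I_m -> M),
    forall x : M, exists c : 'I_m -> R, x = \sum_(i < m) c i *: g i.

Definition projective (R : pzRingType) (P : lmodType R) : Prop :=
  forall (M N : lmodType R) (g : {linear M -> N}) (f : {linear P -> N}),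
    surj g -> exists h : {linear P -> M}, f =1 g \o h.

Definition is_ideal (k : comPzRingType) (I : k -> Prop) : Prop :=
  [/\ I 0, forall x y, I x -> I y -> I (x + y) & forall a x, I x -> I (a * x)].

Definition artinian (k : comPzRingType) : Prop :=
  forall I : nat -> k -> Prop,
    (forall m, is_ideal (I m)) -> (forall m x, I m.+1 x -> I m x) ->
    exists N, forall m x, (N <= m)%N -> I N x -> I m x.

(* The k-algebra structure is given by its structure map [f]: [algType k]
   would exclude the zero algebra. *)
Definition artin_algebra (A : pzRingType) : Prop :=
  exists (k : comPzRingType) (f : {rmorphism k -> A}),
    [/\ artinian k,
        forall c a, f c * a = a * f c
      & exists (m : nat) (g : 'I_m -> A),
          forall a, exists c : 'I_m -> k, a = \sum_(i < m) f (c i) * g i].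

Section Ext.
Variable R : pzRingType.

Record proj_resolution (Z : lmodType R) := ProjResolution {
  res_obj : nat -> lmodType R;
  res_d : forall m, {linear res_obj m.+1 -> res_obj m};
  res_aug : {linear res_obj 0%N -> Z};
  res_proj : forall m, projective (res_obj m);
  res_aug_surj : surj res_aug;
  res_exact0 : forall x, res_aug x = 0 <-> exists y, res_d 0 y = x;
  res_exact : forall m x, res_d m x = 0 <-> exists y, res_d m.+1 y = x
}.

Section Cochains.
Variables (Z M : lmodType R) (P : proj_resolution Z).

Definition cocycle m (f : {linear res_obj P m -> M}) : Prop :=
  forall x, f (res_d P m x) = 0.

Definition coboundary m : {linear res_obj P m -> M} -> Prop :=
  match m with
  | 0%N => fun f => forall x, f x = 0
  | m'.+1 => fun f => exists g : {linear res_obj P m' -> M}, f =1 g \o res_d P m'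
  end.

End Cochains.

(* Ext^m_R(Z, M) = 0, i.e., Hom_R(P, M) is exact at m for a projective
   resolution P of Z.  Resolutions always exist, and the choice of P is
   irrelevant by the comparison theorem. *)
Definition Ext_vanishes (m : nat) (Z M : lmodType R) : Prop :=
  exists P : proj_resolution Z,
    forall f : {linear res_obj P m -> M}, cocycle f -> coboundary f.

Definition semi_Gproj (Z : lmodType R) : Prop :=
  forall m, (1 <= m)%N -> Ext_vanishes m Z R^o.

End Ext.

Section Gorenstein.
Variable R : pzRingType.

(* Every integer is of the form i + 1, so that these conditions, for all i,
   express exactness (hence also d \o d = 0) at every spot. *)
Definition acyclic (P : int -> lmodType R)
    (d : forall i : int, {linear P i -> P (i + 1)}) : Prop :=
  forall (i : int) (x : P (i + 1)), d (i + 1) x = 0 <-> exists y, d i y = x.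

Definition Hom_acyclic (P : int -> lmodType R)
    (d : forall i : int, {linear P i -> P (i + 1)}) (Q : lmodType R) : Prop :=
  forall (i : int) (f : {linear P (i + 1) -> Q}),
    (forall x, f (d i x) = 0) <->
    exists g : {linear P (i + 1 + 1) -> Q}, f =1 g \o d (i + 1).

(* G is isomorphic to Ker (d 0) through [iota]. *)
Definition Gproj (G : lmodType R) : Prop :=
  exists (P : int -> lmodType R) (d : forall i : int, {linear P i -> P (i + 1)}),
    [/\ forall i, fin_gen (P i) /\ projective (P i),
        acyclic d,
        forall Q : lmodType R, fin_gen Q -> projective Q -> Hom_acyclic d Q
      & exists iota : {linear G -> P 0},
          injective iota /\ forall x, d 0 x = 0 <-> exists y, iota y = x].

Definition left_weakly_Gorenstein : Prop :=
  forall Z : lmodType R, fin_gen Z -> semi_Gproj Z -> Gproj Z.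

End Gorenstein.

Definition dual_map (A : pzRingType) (U V : lmodType A) (f : {linear U -> V})
    (g : {linear V -> A^o}) : {linear U -> A^o} := g \o f.

Definition dual_epi (A : pzRingType) (U V : lmodType A) (f : {linear U -> V}) :
    Prop :=
  forall h : {linear U -> A^o}, exists g : {linear V -> A^o}, dual_map f g =1 h.

Section Coker.
Variables (A : pzRingType) (U V : lmodType A) (f : {linear U -> V}).

Definition img : {pred V} := fun v => `[< exists u, f u = v >].

Lemma imgP v : reflect (exists u, f u = v) (v \in img).
Proof. exact: asboolP. Qed.

Lemma img_zmod_closed : zmod_closed img.
Proof.
split; first by apply/imgP; exists 0; rewrite raddf0.
move=> x y /imgP[u <-] /imgP[v <-].
by apply/imgP; exists (u - v); rewrite raddfB.
Qed.
HB.instance Definition _ := GRing.isZmodClosed.Build V img img_zmod_closed.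

Definition coker : Type := Quotient.quot (img : zmodClosed V).
HB.instance Definition _ := GRing.Zmodule.on coker.

Definition coker_pi (v : V) : coker := \pi_(Quotient.quot (img : zmodClosed V)) v.

Lemma coker_piP (v w : V) : coker_pi v = coker_pi w <-> exists u, f u = v - w.
Proof.
have E : (coker_pi v == coker_pi w) = (v - w \in img).
  by rewrite -(Quotient.idealrBE (img : zmodClosed V)).
split=> [/eqP|h]; first by rewrite E => /imgP.
by apply/eqP; rewrite E; apply/imgP.
Qed.

Lemma coker_piD v w : coker_pi (v + w) = coker_pi v + coker_pi w.
Proof. exact: (raddfD \pi_(Quotient.quot (img : zmodClosed V))). Qed.

Lemma coker_reprK q : coker_pi (repr q) = q.
Proof. exact: reprK. Qed.

Definition coker_scale (a : A) (q : coker) : coker := coker_pi (a *: repr q).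

Lemma coker_piZ a v : coker_pi (a *: v) = coker_scale a (coker_pi v).
Proof.
apply/coker_piP; have /coker_piP[u fu] := esym (coker_reprK (coker_pi v)).
by exists (a *: u); rewrite linearZ_LR /= fu scalerBr.
Qed.

Lemma coker_scaleA a b q :
  coker_scale a (coker_scale b q) = coker_scale (a * b) q.
Proof. by rewrite -[q]coker_reprK -!coker_piZ scalerA. Qed.

Lemma coker_scale1 : left_id 1 coker_scale.
Proof. by move=> q; rewrite -[q]coker_reprK -!coker_piZ scale1r. Qed.

Lemma coker_scaleDr : right_distributive coker_scale +%R.
Proof.
move=> a p q; rewrite -[p]coker_reprK -[q]coker_reprK.
by rewrite -coker_piD -!coker_piZ scalerDr coker_piD.
Qed.

Lemma coker_scaleDl q : {morph coker_scale^~ q : a b / a + b}.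
Proof.
by move=> a b; rewrite -[q]coker_reprK -!coker_piZ scalerDl coker_piD.
Qed.

HB.instance Definition _ := GRing.Zmodule_isLmodule.Build A coker
  coker_scaleA coker_scale1 coker_scaleDr coker_scaleDl.

End Coker.

Section Triangular.
Variables (A : pzRingType) (n : nat).

(* [is_trig_mx] means lower triangular *)
Definition utri : {pred 'M[A]_n} := fun t => is_trig_mx t^T.

Lemma utriP (t : 'M[A]_n) :
  reflect (forall i j : 'I_n, (j < i)%N -> t i j = 0) (t \in utri).
Proof.
apply: (iffP is_trig_mxP) => h i j /h; first by rewrite mxE.
by rewrite mxE.
Qed.

Lemma utri_subring_closed : subring_closed utri.
Proof.
split.
- apply/utriP => i j ji; rewrite mxE; case: eqP ji => // ->.
  by rewrite ltnn.
- move=> s t /utriP hs /utriP ht; apply/utriP => i j ji.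
  by rewrite !mxE hs // ht // subrr.
- move=> s t /utriP hs /utriP ht; apply/utriP => i j ji.
  rewrite mxE big1 // => l _; case: (ltnP l i) => [li|il].
    by rewrite hs // mul0r.
  by rewrite ht ?mulr0 // (leq_trans ji).
Qed.
HB.instance Definition _ :=
  GRing.isSubringClosed.Build 'M[A]_n utri utri_subring_closed.

Record tri := Tri { tri_mx :> 'M[A]_n; _ : tri_mx \in utri }.
HB.instance Definition _ := [isSub for tri_mx].
HB.instance Definition _ := [Choice of tri by <:].
HB.instance Definition _ := GRing.SubChoice_isSubPzRing.Build _ _ tri
  utri_subring_closed.

End Triangular.

Notation "''T_' n ( A )" := (tri A n)
  (at level 8, n at level 2, format "''T_' n ( A )") : type_scope.

(* X_1, ..., X_n are X 0, ..., X (n-1); the map phi_(i+1) goes from X i to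
   X (i+1), for i + 1 < n. *)
Definition tri_maps (A : pzRingType) (n : nat) (X : 'I_n -> lmodType A) : Type :=
  forall (i : nat) (h : (i.+1 < n)%N),
    {linear X (Ordinal (ltnW h)) -> X (Ordinal h)}.

(* The module structure defined below depends on the maps. *)
Definition tri_module (A : pzRingType) (n : nat) (X : 'I_n -> lmodType A)
    (phi : tri_maps X) : Type := {dffun forall i, X i}.

Section TriModule.
Variables (A : pzRingType) (n : nat) (X : 'I_n -> lmodType A) (phi : tri_maps X).

Definition cast_lin (i j : 'I_n) (e : i = j) : {linear X i -> X j} :=
  match e with erefl => idfun end.

Fixpoint comp_to (i : 'I_n) (m : nat) :
    forall h : (m < n)%N, {linear X i -> X (Ordinal h)} :=
  match m with
  | 0%N => fun h =>
      match i =P Ordinal h with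
      | ReflectT e => cast_lin e
      | ReflectF _ => \0
      end
  | m'.+1 => fun h =>
      match i =P Ordinal h with
      | ReflectT e => cast_lin e
      | ReflectF _ => phi h \o comp_to i (ltnW h)
      end
  end.

(* The composite X i -> X j of the maps phi if i <= j (the identity if i = j),
   and 0 if j < i. *)
Definition phi_comp (i j : 'I_n) : {linear X i -> X j} :=
  match j with Ordinal m h => comp_to i h end.

Lemma cast_linE (i j : 'I_n) (e e' : i = j) : cast_lin e =1 cast_lin e'.
Proof. by rewrite (eq_irrelevance e e'). Qed.

Lemma phi_comp_id i : phi_comp i i =1 id.
Proof.
case: i => m h x; case: m h x => [|m] h x /=;
  by case: eqP => [e|//]; rewrite (cast_linE e erefl).
Qed.

Lemma phi_compS i m (h : (m.+1 < n)%N) : i != Ordinal h ->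
  phi_comp i (Ordinal h) =1 phi h \o phi_comp i (Ordinal (ltnW h)).
Proof. by move=> ih x /=; case: eqP ih => // ->; rewrite eqxx. Qed.

Lemma phi_comp_gt (i j : 'I_n) : (j < i)%N -> forall x, phi_comp i j x = 0.
Proof.
case: j => m h /=; elim: m h => [|m IH] h mi x /=;
  case: eqP => [e|_] //=; rewrite ?(congr1 val e) ?ltnn // in mi *.
by rewrite IH ?raddf0 // ltnW.
Qed.

Lemma phi_comp_comp (i j l : 'I_n) : (i <= j)%N -> (j <= l)%N ->
  phi_comp j l \o phi_comp i j =1 phi_comp i l.
Proof.
move=> ij; case: l => m h; elim: m h => [|m IH] h.
  rewrite leqn0 => /eqP j0 x; have <- : j = Ordinal h by apply: val_inj.
  by rewrite /= phi_comp_id.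
rewrite leq_eqVlt => /orP[/eqP jm|jm] x.
  have <- : j = Ordinal h by apply: val_inj.
  by rewrite /= phi_comp_id.
have nj : j != Ordinal h by rewrite -val_eqE /= neq_ltn jm.
have ni : i != Ordinal h by rewrite -val_eqE /= neq_ltn (leq_ltn_trans ij).
rewrite /comp (phi_compS nj) (phi_compS ni) /=; congr (phi h _).
exact: IH.
Qed.

HB.instance Definition _ := Choice.on (tri_module phi).

Implicit Types x y z : tri_module phi.

Definition tri_module_add x y : tri_module phi := [ffun i => x i + y i].
Definition tri_module_opp x : tri_module phi := [ffun i => - x i].
Definition tri_module_zero : tri_module phi := [ffun i => 0].

Lemma tri_module_addA : associative tri_module_add.
Proof. by move=> x y z; apply/ffunP => i; rewrite !ffunE addrA. Qed.
Lemma tri_module_addC : commutative tri_module_add.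
Proof. by move=> x y; apply/ffunP => i; rewrite !ffunE addrC. Qed.
Lemma tri_module_add0 : left_id tri_module_zero tri_module_add.
Proof. by move=> x; apply/ffunP => i; rewrite !ffunE add0r. Qed.
Lemma tri_module_addN : left_inverse tri_module_zero tri_module_opp tri_module_add.
Proof. by move=> x; apply/ffunP => i; rewrite !ffunE addNr. Qed.

HB.instance Definition _ := GRing.isZmodule.Build (tri_module phi)
  tri_module_addA tri_module_addC tri_module_add0 tri_module_addN.

Lemma tri_moduleD x y i : (x + y) i = x i + y i.
Proof. by rewrite ffunE. Qed.

(* Matrix times column; the top entry of the column, matched with row and
   column 0 of the matrix, is the one in X_n, whence [rev_ord]. *)
Definition tri_module_scale (t : 'T_n(A)) x : tri_module phi :=
  [ffun j => \sum_(i < n) t (rev_ord j) (rev_ord i) *: phi_comp i j (x i)].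

Lemma tri_rev (t : 'T_n(A)) (i j : 'I_n) :
  (j < i)%N -> t (rev_ord j) (rev_ord i) = 0.
Proof.
case: t => t /= /utriP ht ji; apply: ht => /=.
by apply: ltn_sub2l => //; apply: leq_ltn_trans ji (ltn_ord i).
Qed.

Lemma tri_module_scaleA s t x :
  tri_module_scale s (tri_module_scale t x) = tri_module_scale (s * t) x.
Proof.
apply/ffunP => l; rewrite !ffunE.
under eq_bigr => j _ do rewrite ffunE raddf_sum scaler_sumr.
rewrite exchange_big /=; apply: eq_bigr => i _.
rewrite mxE scaler_suml [RHS](reindex_inj rev_ord_inj) /=.
apply: eq_bigr => j _; rewrite linearZ_LR /= scalerA.
case: (ltnP j i) => [ji|ij]; first by rewrite (tri_rev t ji) mulr0 !scale0r.
case: (ltnP l j) => [lj|jl]; first by rewrite (tri_rev s lj) mul0r !scale0r.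
by congr (_ *: _); exact: phi_comp_comp.
Qed.

Lemma tri_module_scale1 : left_id 1 tri_module_scale.
Proof.
move=> x; apply/ffunP => j; rewrite ffunE (bigD1 j) //= big1 => [|i ij].
  by rewrite mxE eqxx scale1r phi_comp_id addr0.
by rewrite mxE (inj_eq rev_ord_inj) eq_sym (negbTE ij) scale0r.
Qed.

Lemma tri_module_scaleDr : right_distributive tri_module_scale +%R.
Proof.
move=> t x y; apply/ffunP => j; rewrite !ffunE -big_split /=.
by apply: eq_bigr => i _; rewrite ffunE raddfD scalerDr.
Qed.

Lemma tri_module_scaleDl x : {morph tri_module_scale^~ x : s t / s + t}.
Proof.
move=> s t; apply/ffunP => j; rewrite !ffunE -big_split /=.
by apply: eq_bigr => i _; rewrite mxE scalerDl.
Qed.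

HB.instance Definition _ := GRing.Zmodule_isLmodule.Build 'T_n(A) (tri_module phi)
  tri_module_scaleA tri_module_scale1 tri_module_scaleDr tri_module_scaleDl.

End TriModule.

(* Main.v *)
From HB Require Import structures.
From mathcomp Require Import all_boot all_order all_algebra.
From mathcomp Require Import boolp functions.
Require Import Defs.

(* The Gorenstein-projective modules form the largest class of modules each
   member X of which fits, within the class, into short exact sequences
   0 -> X -> P -> Y -> 0 and 0 -> K -> P -> X -> 0 with P finitely generated
   projective such that all maps from the left-hand term to R extend to P; the
   semi-Gorenstein-projective ones form the largest class with the second half
   of this property, P being any projective.  So membership is shown by
   exhibiting a class.

   For a T_n(A)-module Z = (X_n, ..., X_1), a map Z -> T_n(A) amounts to a family
   of maps g_j : X_n -> A, 1 <= j <= n, with g_j zero on the image of X_k for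
   k < j.  If Z is projective, then every map from X_i extends along X_i -> X_n.
   Chasing these two facts through the sequences above gives (1) and the "only
   if" part of (2).  For the "if" part, the submodule generated by the first
   nonzero X_j is (X_j, ..., X_j, 0, ..., 0), which is Gorenstein-projective, and
   its quotient is of the same kind with one more zero; conclude by induction,
   Gorenstein-projective modules being closed under extensions (horseshoe).
   (3) follows from (1) and (2): Gorenstein-projective modules are torsionless,
   so surjectivity of the dual of phi_i makes phi_i injective, and then its
   cokernel is again semi-Gorenstein-projective. *)

Set Implicit Arguments.
Unset Strict Implicit.
Unset Printing Implicit Defensive.

Import GRing.Theory.
Local Open Scope ring_scope.

(** * Linear maps and projective modules *)

Section LinearMaps.
Variable R : pzRingType.
Implicit Types U V W P X Y : lmodType R.

(** Maps are written as plain functions, proved linear, and from then on known only through their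
    pointwise equation. *)
Lemma linear_of U V (f : U -> V) : linear f -> exists h : {linear U -> V}, h =1 f.
Proof.
move=> fL.
by exists (HB.pack_for {linear U -> V} f (GRing.isLinear.Build R U V *:%R f fL)).
Qed.

Lemma subker_inj U V (f : {linear U -> V}) : (forall x, f x = 0 -> x = 0) -> injective f.
Proof.
move=> f0 x y fxy; apply/eqP; rewrite -subr_eq0; apply/eqP; apply: f0.
by rewrite raddfB /= fxy subrr.
Qed.

Lemma factor_inj U V W (i : {linear U -> V}) (f : {linear W -> V}) : injective i ->
  (forall x, exists u, i u = f x) -> exists h : {linear W -> U}, forall x, i (h x) = f x.
Proof.
move=> iI /choice[h hE].
have hL : linear h.
  by move=> a x y; apply: iI; rewrite linearP !hE linearP.
by have [h' h'E] := linear_of hL; exists h' => x; rewrite h'E.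
Qed.

(** The section [s] comes from choice and need not be linear; [f \o s] is, because [f] takes equal
    values on any two preimages of an element. *)
Lemma factor_surj U V W (p : {linear U -> V}) (f : {linear U -> W}) : surj p ->
  (forall x, p x = 0 -> f x = 0) -> exists h : {linear V -> W}, forall x, h (p x) = f x.
Proof.
move=> /choice[s sE] pf.
have key x y : p x = p y -> f x = f y.
  move=> pxy; apply/eqP; rewrite -subr_eq0; apply/eqP; rewrite -linearB.
  by apply: pf; rewrite linearB /= pxy subrr.
have hL : linear (f \o s).
  by move=> a x y /=; rewrite -linearP; apply: key; rewrite linearP !sE.
by have [h hE] := linear_of hL; exists h => x; rewrite hE; apply: key; rewrite sE.
Qed.

Lemma cokerP U V (f : {linear U -> V}) : exists p : {linear V -> coker f},
  surj p /\ forall x, p x = 0 <-> exists u, f u = x.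
Proof.
have pL : linear (@coker_pi _ _ _ f).
  by move=> a x y; rewrite coker_piD coker_piZ.
have [p pE] := linear_of pL; exists p; split=> [q|x].
  by exists (repr q); rewrite pE coker_reprK.
rewrite -(linear0 p) !pE; split=> [/coker_piP[u]|[u <-]]; last first.
  by apply/coker_piP; exists u; rewrite subr0.
by rewrite subr0; exists u.
Qed.

Definition kerp U V (f : {linear U -> V}) : {pred U} := fun x => f x == 0.
Lemma kerp_submod U V (f : {linear U -> V}) : submod_closed (kerp f).
Proof.
split; first by rewrite /in_mem /= /kerp raddf0.
by move=> a x y /eqP fx /eqP fy; rewrite /in_mem /= /kerp linearP fx fy scaler0 addr0.
Qed.
End LinearMaps.

Section Kernel.
Variables (R : pzRingType) (U V : lmodType R) (f : {linear U -> V}).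
HB.instance Definition _ := GRing.isSubmodClosed.Build R U (kerp f) (kerp_submod f).
Record kernel := Kernel { kernel_val : U; _ : kernel_val \in kerp f }.
HB.instance Definition _ := [isSub for kernel_val].
HB.instance Definition _ := [Choice of kernel by <:].
HB.instance Definition _ := [SubChoice_isSubLmodule of kernel by <:].
Lemma kernelP : exists (K : lmodType R) (i : {linear K -> U}),
  injective i /\ forall x, f x = 0 <-> exists k, i k = x.
Proof.
exists kernel, val; split=> [|x]; first exact: val_inj.
split=> [fx|[[k kP] /= <-]]; last exact/eqP.
have xK : x \in kerp f by exact/eqP.
by exists (Kernel xK).
Qed.
End Kernel.

(** * Free modules on arbitrary sets *)

Section FreeModule.
Variables (R : pzRingType) (B : eqType).

Definition fin_supp : {pred B -> R^o} :=
  fun c => `[< exists s : seq B, forall x, x \notin s -> c x = 0 >].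

Lemma fin_supp_submod : submod_closed fin_supp.
Proof.
split; first by apply/asboolP; exists [::].
move=> a c d /asboolP[s cs] /asboolP[t dt]; apply/asboolP; exists (s ++ t) => x.
rewrite mem_cat negb_or => /andP[/cs cx /dt dx].
by transitivity (a *: c x + d x); rewrite // cx dx scaler0 addr0.
Qed.
HB.instance Definition _ :=
  GRing.isSubmodClosed.Build R (B -> R^o) fin_supp fin_supp_submod.

Record free_mod := FreeMod { free_val : B -> R^o; _ : free_val \in fin_supp }.
HB.instance Definition _ := [isSub for free_val].
HB.instance Definition _ := [Choice of free_mod by <:].
HB.instance Definition _ := [SubChoice_isSubLmodule of free_mod by <:].

Lemma free_base_subproof b : (fun x => (x == b)%:R : R^o) \in fin_supp.
Proof.
by apply/asboolP; exists [:: b] => x; rewrite inE => /negbTE ->.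
Qed.
Definition free_base b : free_mod := FreeMod (free_base_subproof b).
Definition coef (c : free_mod) (b : B) : R := free_val c b.

Lemma coef_linear b : linear (fun c => coef c b : R^o).
Proof. by []. Qed.

Lemma free_suppP (c : free_mod) :
  exists s : seq B, uniq s /\ forall x, x \notin s -> coef c x = 0.
Proof.
case: c => c /= /asboolP[s cs]; exists (undup s).
by rewrite undup_uniq; split=> // x; rewrite mem_undup; apply: cs.
Qed.

Section Lift.
Variables (V : lmodType R) (v : B -> V).

(** After dropping zero coefficients, both lists enumerate the support without repetition, so they
    are permutations of each other. Hence the linear extension does not depend on the list that
    bounds the support. *)
Lemma free_sum_eq (c : free_mod) (s t : seq B) : uniq s -> uniq t ->
  (forall x, x \notin s -> coef c x = 0) ->
  (forall x, x \notin t -> coef c x = 0) ->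
  \sum_(b <- s) coef c b *: v b = \sum_(b <- t) coef c b *: v b.
Proof.
move=> us ut cs ct.
have E r : \sum_(b <- r) coef c b *: v b =
    \sum_(b <- [seq b <- r | coef c b != 0]) coef c b *: v b.
  rewrite big_filter [LHS](bigID (fun b => coef c b != 0)) /= [X in _ + X]big1 ?addr0 //.
  by move=> b /negPn/eqP ->; rewrite scale0r.
rewrite [LHS]E [RHS]E; apply: perm_big; apply: uniq_perm; rewrite ?filter_uniq // => b.
rewrite !mem_filter; case: eqP => //= cb.
by apply/idP/idP => _; apply: contra_notT cb; [apply: ct | apply: cs].
Qed.

Lemma free_lift : exists h : {linear free_mod -> V}, forall c s, uniq s ->
  (forall x, x \notin s -> coef c x = 0) ->
  h c = \sum_(b <- s) coef c b *: v b.
Proof.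
have [s sP] := choice free_suppP.
pose h c := \sum_(b <- s c) coef c b *: v b.
have hE c t : uniq t -> (forall x, x \notin t -> coef c x = 0) ->
    h c = \sum_(b <- t) coef c b *: v b.
  by move=> ut ct; have [us cs] := sP c; apply: free_sum_eq.
have hL : linear h.
  (* A single list bounding all three supports makes the three sums comparable term by term. *)
  move=> a c d; set t := undup (s c ++ s d ++ s (a *: c + d)).
  have ut : uniq t by apply: undup_uniq.
  have sub e r : r = s e -> {subset r <= t} -> forall x, x \notin t -> coef e x = 0.
    by move=> -> st x xt; apply: (sP e).2; apply: contra xt; apply: st.
  rewrite !(hE _ t ut); try by apply: sub (erefl _) _ => x xs;
    rewrite mem_undup !mem_cat xs ?orbT.
  rewrite scaler_sumr -big_split; apply: eq_bigr => b _ /=.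
  by rewrite scalerA -scalerDl.
by have [h' h'E] := linear_of hL; exists h' => c t ut ct; rewrite h'E; apply: hE.
Qed.

Lemma free_lift_base (h : {linear free_mod -> V}) : (forall c s, uniq s ->
    (forall x, x \notin s -> coef c x = 0) ->
    h c = \sum_(b <- s) coef c b *: v b) ->
  forall b, h (free_base b) = v b.
Proof.
move=> hE b; rewrite (hE _ [:: b]) //= => [|x]; last by rewrite inE => /negbTE ->.
by rewrite big_seq1 eqxx scale1r.
Qed.
End Lift.

Lemma free_ext (V : lmodType R) (h k : {linear free_mod -> V}) :
  (forall b, h (free_base b) = k (free_base b)) -> h =1 k.
Proof.
move=> hk c; have [s [us cs]] := free_suppP c.
have -> : c = \sum_(b <- s) coef c b *: free_base b.
  apply: val_inj; apply/funext => x.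
  have [e eE] := linear_of (coef_linear x).
  rewrite -[LHS]/(coef c x) -[RHS]/(coef _ x) -[RHS]eE linear_sum.
  under eq_bigr => b _ do rewrite linearZ_LR eE [coef _ _]/=.
  case: (boolP (x \in s)) => [xs|xs].
    rewrite (bigD1_seq x) //= big1 => [|b bx]; first by rewrite eqxx [RHS]addr0 [RHS]mulr1.
    by rewrite eq_sym (negbTE bx) [LHS]mulr0.
  rewrite cs // big_seq big1 // => b bs.
  rewrite /coef /= (_ : x == b = false) ?[LHS]mulr0 //.
  by apply: contraNF xs => /eqP ->.
by rewrite !linear_sum; apply: eq_bigr => b _; rewrite !linearZ_LR hk.
Qed.

Lemma free_projective : projective free_mod.
Proof.
move=> M N g f /choice[s sE]; have [h hE] := free_lift (fun b => s (f (free_base b))).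
exists h; apply: (free_ext (h := f) (k := g \o h)) => b /=.
by rewrite (free_lift_base hE) sE.
Qed.
End FreeModule.

(** * Projective modules *)

Section Projective.
Variable R : pzRingType.
Implicit Types U V W P X Y Z : lmodType R.

(** The cover is free on the whole underlying set of Z. It may be infinitely generated, which
    resolutions allow. *)
Lemma projective_cover Z :
  exists (P : lmodType R) (p : {linear P -> Z}), projective P /\ surj p.
Proof.
have [p pE] := @free_lift R Z Z id.
exists (free_mod R Z), p; split; first exact: free_projective.
by move=> z; exists (free_base _ z); rewrite (free_lift_base pE).
Qed.

(** Projectivity speaks of surjections, so [g] is first corestricted to its image, realised as the
    kernel of its cokernel map. *)
Lemma projective_lift P U V (g : {linear U -> V}) (f : {linear P -> V}) :
  projective P -> (forall x, exists u, g u = f x) ->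
  exists h : {linear P -> U}, forall x, g (h x) = f x.
Proof.
move=> Pp fg; have [q [_ qE]] := cokerP g; have [K [i [iI iE]]] := kernelP q.
have [|g' g'E] := factor_inj (f := g) iI.
  by move=> u; apply/iE/qE; exists u.
have [|f' f'E] := factor_inj (f := f) iI.
  by move=> x; apply/iE/qE; apply: fg.
have [|h hE] := Pp _ _ g' f'.
  move=> k; have /qE[u uE] : q (i k) = 0 by apply/iE; exists k.
  by exists u; apply: iI; rewrite g'E.
by exists h => x; rewrite -f'E hE /= g'E.
Qed.

Lemma projective_prod P Q : projective P -> projective Q -> projective (P * Q)%type.
Proof.
move=> Pp Qp M N g f gS.
have l1 : linear (fun x : P => (x, 0 : Q)).
  by move=> a x y; congr (_, _); rewrite /= scaler0 addr0.
have l2 : linear (fun x : Q => (0 : P, x)).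
  by move=> a x y; congr (_, _); rewrite /= scaler0 addr0.
have [i1 i1E] := linear_of l1; have [i2 i2E] := linear_of l2.
have [h1 h1E] := Pp _ _ g (f \o i1) gS; have [h2 h2E] := Qp _ _ g (f \o i2) gS.
exists ((h1 \o fst) \+ (h2 \o snd)) => -[x y] /=.
rewrite linearD -[g (h1 x)]h1E -[g (h2 y)]h2E /= i1E i2E -linearD.
by congr (f (_, _)); rewrite /= ?addr0 ?add0r.
Qed.

Lemma fin_gen_surj U V (f : {linear U -> V}) : surj f -> fin_gen U -> fin_gen V.
Proof.
move=> fS [m [g gE]]; exists m, (f \o g) => v; have [u <-] := fS v.
have [c ->] := gE u; exists c; rewrite linear_sum.
by apply: eq_bigr => i _; rewrite linearZ_LR.
Qed.

Lemma fin_gen_prod U V : fin_gen U -> fin_gen V -> fin_gen (U * V)%type.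
Proof.
move=> [m [g gE]] [m' [g' g'E]].
exists (m + m')%N,
  (fun i => match fintype.split i with inl j => (g j, 0) | inr j => (0, g' j) end).
move=> [x y]; have [c cE] := gE x; have [c' c'E] := g'E y.
exists (fun i => match fintype.split i with inl j => c j | inr j => c' j end).
rewrite big_split_ord /=.
under eq_bigr => i _ do rewrite (unsplitK (inl i : 'I_m + 'I_m')).
under [X in _ + X]eq_bigr => i _ do rewrite (unsplitK (inr i : 'I_m + 'I_m')).
rewrite [x]cE [y]c'E [LHS]surjective_pairing [RHS]surjective_pairing /=.
rewrite !(raddf_sum fst) !(raddf_sum snd) /=.
congr (_, _); last first.
  by rewrite [X in X + _]big1 ?add0r // => i _; rewrite scaler0.
by rewrite [X in _ + X]big1 ?addr0 // => i _; rewrite scaler0.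
Qed.

(* A finitely generated projective module is a direct summand of R^m, whence
   finitely many coordinate functionals. *)
Lemma fgproj_coord P : fin_gen P -> projective P ->
  exists (m : nat) (g : 'I_m -> P) (c : 'I_m -> {linear P -> R^o}),
    forall x, x = \sum_i (c i x : R) *: g i.
Proof.
move=> [m [g gE]] Pp; exists m, g.
pose p (c : 'I_m -> R^o) := \sum_i (c i : R) *: g i.
have pL : linear p.
  move=> a c d; rewrite /p scaler_sumr -big_split; apply: eq_bigr => i _ /=.
  by rewrite scalerA -scalerDl.
have [q qE] := linear_of pL.
have qS : surj q by move=> x; have [c cE] := gE x; exists c; rewrite qE cE.
have [s sE] := Pp _ _ q idfun qS.
have cL i : linear (fun x => s x i) by move=> a x y; rewrite linearP.
have [c cE] := choice (fun i => linear_of (cL i)); exists c => x.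
by rewrite [LHS]sE /= qE; apply: eq_bigr => i _; rewrite cE.
Qed.
End Projective.

(** * Classes of Gorenstein-projective modules *)

Section Steps.
Variable R : pzRingType.
Implicit Types U V W P Q X Y Z K G : lmodType R.

Definition ses K P Y (i : {linear K -> P}) (p : {linear P -> Y}) : Prop :=
  [/\ injective i, surj p & forall x, p x = 0 <-> exists k, i k = x].

(** In a short exact sequence X -> P -> Y with P projective, this condition says that Ext^1(Y, Q) =
    0. *)
Definition extends X P (i : {linear X -> P}) Q : Prop :=
  forall f : {linear X -> Q}, exists g : {linear P -> Q}, forall x, g (i x) = f x.

Definition fgproj P : Prop := fin_gen P /\ projective P.

(** The class [c] of middle terms is a parameter, so that the same transfer lemmas serve [fgproj] in
    the Gorenstein-projective case and [projective] in the semi-Gorenstein-projective one. *)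
Definition step (c : lmodType R -> Prop) X Y : Prop :=
  exists P (i : {linear X -> P}) (p : {linear P -> Y}),
    [/\ c P, ses i p & extends i R^o].

Definition Gstable (C : lmodType R -> Prop) : Prop := forall X, C X ->
  (exists Y, C Y /\ step fgproj X Y) /\ (exists Y, C Y /\ step fgproj Y X).

Definition semistable (C : lmodType R -> Prop) : Prop := forall X, C X ->
  exists Y, C Y /\ step (@projective R) Y X.

Lemma ses0 K P Y (i : {linear K -> P}) (p : {linear P -> Y}) :
  ses i p -> forall k, p (i k) = 0.
Proof. by case=> _ _ E k; apply/E; exists k. Qed.

Lemma kernel_ses U V (p : {linear U -> V}) : surj p ->
  exists K (i : {linear K -> U}), ses i p.
Proof. by move=> pS; have [K [i [iI E]]] := kernelP p; exists K, i. Qed.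

Lemma coker_ses U V (i : {linear U -> V}) : injective i ->
  exists (C : lmodType R) (p : {linear V -> C}), ses i p.
Proof. by move=> iI; have [p [pS E]] := cokerP i; exists (coker i), p. Qed.

(** The finitely many coordinate functionals of Q reduce the problem to maps into R: each coordinate
    of [f] is extended separately. *)
Lemma extends_fgproj X P (i : {linear X -> P}) Q :
  extends i R^o -> fgproj Q -> extends i Q.
Proof.
move=> iE [Qf Qp] f; have [m [g [c cE]]] := fgproj_coord Qf Qp.
have [e eE] := choice (fun j => iE (c j \o f)).
pose h x := \sum_j (e j x : R) *: g j.
have hL : linear h.
  move=> a x y; rewrite /h scaler_sumr -big_split; apply: eq_bigr => j _ /=.
  by rewrite linearP scalerDl scalerA.
have [h' h'E] := linear_of hL; exists h' => x.
by rewrite h'E [RHS]cE; apply: eq_bigr => j _; rewrite eE.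
Qed.

Lemma pair_map U V W (f : {linear U -> V}) (g : {linear U -> W}) :
  exists h : {linear U -> (V * W)%type}, forall x, h x = (f x, g x).
Proof.
have L : linear (fun x => (f x, g x)) by move=> a x y; rewrite !linearP.
by have [h hE] := linear_of L; exists h.
Qed.

Lemma copair_map U V W (f : {linear V -> U}) (g : {linear W -> U}) :
  exists h : {linear (V * W)%type -> U}, forall x y, h (x, y) = f x + g y.
Proof. by exists ((f \o fst) \+ (g \o snd)). Qed.

(** * Horseshoe lemmas for steps to the left and to the right *)

Section Horseshoe.
Variables (G' G G'' : lmodType R) (j : {linear G' -> G}) (q : {linear G -> G''}).
Hypothesis jq : ses j q.

(** The cover of G is [j \o p'] on P' plus a lift [s] of [p''] through [q] on P''. To extend [f]
    from K, first extend its restriction to K' by [a]; what remains vanishes on K', hence descends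
    to K'', and is extended from there to P''. *)
Lemma horseshoe_left K' P' K'' P'' (i' : {linear K' -> P'}) (p' : {linear P' -> G'})
    (i'' : {linear K'' -> P''}) (p'' : {linear P'' -> G''}) :
  projective P'' -> ses i' p' -> ses i'' p'' -> extends i' R^o -> extends i'' R^o ->
  exists K (i : {linear K -> (P' * P'')%type}) (p : {linear (P' * P'')%type -> G})
    (jK : {linear K' -> K}) (qK : {linear K -> K''}),
    [/\ ses i p, ses jK qK & extends i R^o].
Proof.
case: jq => jI qS jqE Pp [iI' pS' E'] [iI'' pS'' E''] x' x''.
have [s sE] := Pp _ _ q p'' qS.
have [p pE] := copair_map (j \o p') s.
have pS : surj p.
  move=> g; have [y yE] := pS'' (q g).
  have /jqE[u uE] : q (g - s y) = 0 by rewrite linearB /= -[q (s y)]sE yE subrr.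
  have [z zE] := pS' u; exists (z, y).
  by rewrite pE /= zE uE subrK.
have [K [i [iI _ iE]]] := kernel_ses pS.
have [l lE] := pair_map i' (\0 : {linear K' -> P''}).
have [jK jKE] : exists jK : {linear K' -> K}, forall x, i (jK x) = l x.
  apply: factor_inj => // x; apply/iE; rewrite lE pE /= linear0 addr0.
  by rewrite (E' _).2 ?linear0 //; exists x.
have [qK qKE] : exists qK : {linear K -> K''}, forall x, i'' (qK x) = (i x).2.
  apply: (factor_inj (f := snd \o i)) => // x; apply/E''.
  rewrite [p'' _]sE /=.
  have : p (i x) = 0 by apply/iE; exists x.
  rewrite [i x]surjective_pairing pE /= => /eqP; rewrite addrC addr_eq0 => /eqP ->.
  by rewrite linearN /= (jqE _).2 ?oppr0 //; exists (p' (i x).1).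
have jqK : ses jK qK.
  split=> [x y e|y|x].
  - apply: iI'; have : l x = l y by rewrite -!jKE e.
    by rewrite !lE => -[].
  - have /jqE[u uE] : q (s (i'' y)) = 0 by rewrite -[LHS]sE; apply/E''; exists y.
    have [z zE] := pS' u.
    have /iE[k kE] : p (- z, i'' y) = 0 by rewrite pE /= !linearN zE uE addNr.
    by exists k; apply: iI''; rewrite qKE kE.
  - split=> [qx|[k <-]]; last by apply: iI''; rewrite qKE jKE lE linear0.
    have x2 : (i x).2 = 0 by rewrite -qKE qx linear0.
    have /E'[k kE] : p' (i x).1 = 0.
      have : p (i x) = 0 by apply/iE; exists x.
      by rewrite [i x]surjective_pairing x2 pE /= linear0 addr0 -(linear0 j) => /jI.
    by exists k; apply: iI; rewrite jKE lE kE [RHS]surjective_pairing x2.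
exists K, i, p, jK, qK; split=> // f.
have [a aE] := x' (f \o jK).
have [b bE] : exists b : {linear K'' -> R^o}, forall x, b (qK x) = f x - a (i x).1.
  have [_ qKS jqKE] := jqK.
  apply: (factor_surj (f := f \- (a \o (fst \o i)))) => // x /jqKE[k <-] /=.
  by rewrite jKE lE /= aE subrr.
have [c cE] := x'' b; have [h hE] := copair_map a c.
by exists h => x; rewrite [i x]surjective_pairing hE -qKE cE bE addrC subrK.
Qed.

(** Dual construction: the first component of the embedding of G is an extension [a] of [i'] along
    [j]. This is where [extends j P'] takes the place of the projectivity of P'' in the left-hand
    version. *)
Lemma horseshoe_right P' Y' P'' Y'' (i' : {linear G' -> P'}) (p' : {linear P' -> Y'})
    (i'' : {linear G'' -> P''}) (p'' : {linear P'' -> Y''}) :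
  extends j P' -> ses i' p' -> ses i'' p'' -> extends i' R^o -> extends i'' R^o ->
  exists Y (i : {linear G -> (P' * P'')%type}) (p : {linear (P' * P'')%type -> Y})
    (jY : {linear Y' -> Y}) (qY : {linear Y -> Y''}),
    [/\ ses i p, ses jY qY & extends i R^o].
Proof.
case: jq => jI qS jqE jx [iI' pS' E'] [iI'' pS'' E''] x' x''.
have [a aE] := jx i'.
have [i iE] := pair_map a (i'' \o q).
have iI : injective i.
  apply: subker_inj => x; rewrite iE => -[ax /= qx].
  have /jqE[u uE] : q x = 0 by apply: iI''; rewrite qx linear0.
  by rewrite -uE (_ : u = 0) ?linear0 //; apply: iI'; rewrite -aE uE ax linear0.
have [Y [p [_ pS pE]]] := coker_ses iI.
have [l lE] := pair_map (idfun : {linear P' -> P'}) (\0 : {linear P' -> P''}).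
have [jY jYE] : exists jY : {linear Y' -> Y}, forall x, jY (p' x) = p (l x).
  apply: (factor_surj (f := p \o l)) => // x /E'[g <-]; apply/pE; exists (j g).
  by rewrite iE lE aE /= (jqE _).2 ?linear0 //; exists g.
have [qY qYE] : exists qY : {linear Y -> Y''}, forall x, qY (p x) = p'' x.2.
  apply: (factor_surj (f := p'' \o snd)) => // x /pE[g <-] /=; apply/E''.
  by exists (q g); rewrite iE.
exists Y, i, p, jY, qY; split=> //.
- split=> [|y|y].
  + apply: subker_inj => y; have [z <-] := pS' y.
    rewrite jYE => /pE[g]; rewrite iE lE /= => -[gz qg].
    have /jqE[u uE] : q g = 0 by apply: iI''; rewrite qg linear0.
    by apply/E'; exists u; rewrite -gz -uE aE.
  + by have [z <-] := pS'' y; exists (p (0, z)); rewrite qYE.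
  + have [[z1 z2] <-] := pS y; rewrite qYE /=; split=> [/E''[g gE]|[u]].
      have [h hE] := qS g; exists (p' (z1 - a h)).
      rewrite jYE; apply/eqP; rewrite -subr_eq0 -linearB; apply/eqP/pE; exists (- h).
      rewrite iE lE /= !linearN hE gE; congr (_, _); rewrite /= ?sub0r //.
      by rewrite addrAC subrr sub0r.
    have [v <-] := pS' u; rewrite jYE => e.
    have /pE[g] : p (l v - (z1, z2)) = 0 by rewrite linearB /= e subrr.
    rewrite iE lE => -[_ /= gz].
    by apply/E''; exists (- q g); rewrite linearN gz sub0r opprK.
- move=> f; have [b bE] := x' (f \o j).
  have [c cE] : exists c : {linear G'' -> R^o}, forall x, c (q x) = f x - b (a x).
    apply: (factor_surj (f := f \- (b \o a))) => // x /jqE[u <-] /=.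
    by rewrite aE bE subrr.
  have [d dE] := x'' c; have [h hE] := copair_map b d.
  by exists h => x; rewrite iE hE /= dE cE addrC subrK.
Qed.
End Horseshoe.
End Steps.

(** * Gorenstein-projective modules as a stable class, and their extensions *)

Section GorensteinProjective.
Variable R : pzRingType.
Implicit Types U V W P Q X Y Z K G M : lmodType R.

Lemma dep_choice (I : Type) (T : I -> Type) (Q : forall i, T i -> Prop) :
  (forall i, exists x, Q i x) -> exists f : forall i, T i, forall i, Q i (f i).
Proof.
by move=> h; exists (fun i => sval (cid (h i))) => i; apply: (svalP (cid (h i))).
Qed.

(** Splicing the steps gives a complex whose kernels are the Z i. A map on P (i + 1) that kills the
    image of [d i] descends to the next kernel, and the extension property carries it on to the next
    projective; this is the acyclicity of the Hom complex. *)
Lemma Gproj_chain (Z : int -> lmodType R) :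
  (forall i, step (@fgproj R) (Z i) (Z (i + 1))) -> Gproj (Z 0).
Proof.
move=> /dep_choice[P /dep_choice[iota /dep_choice[pi E]]].
pose d i : {linear P i -> P (i + 1)} := iota (i + 1) \o pi i.
have dE i x : d i x = 0 <-> exists k, iota i k = x.
  have [_ [_ _ <-] _] := E i; have [_ [iI _ _] _] := E (i + 1).
  by split=> [e|e]; [apply: iI; rewrite linear0 | rewrite /= e linear0].
have dS i x : (exists y, d i y = x) <-> exists k, iota (i + 1) k = x.
  have [_ [_ pS _] _] := E i.
  by split=> [[y <-]|[k <-]]; [exists (pi i y) | have [y <-] := pS k; exists y].
exists P, d; split=> [i|i x|Q Qf Qp i f|].
- by have [] := E i.
- by rewrite dS dE.
- have [_ pse _] := E (i + 1); have [_ _ /extends_fgproj x] := E (i + 1 + 1).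
  have [_ pS pE] := pse; split=> [f0|[g gE] x0]; last first.
    rewrite gE; suff -> : (g \o d (i + 1)) (d i x0) = g (d (i + 1) (d i x0)) by
      rewrite (dE _ _).2 ?linear0 //; apply/dS; exists x0.
    by [].
  have [h hE] : exists h : {linear Z (i + 1 + 1) -> Q}, forall x, h (pi (i + 1) x) = f x.
    by apply: factor_surj => // x0 /pE ? ; have /dS[y <-] : exists k, iota (i + 1) k = x0.
  by have [g gE] := x _ (conj Qf Qp) h; exists g => x0 /=; rewrite gE hE.
- by exists (iota 0); split=> [|x]; [have [_ []] := E 0 | apply: dE].
Qed.

Lemma Gstable_Gproj (C : lmodType R -> Prop) G : Gstable C -> C G -> Gproj G.
Proof.
move=> Cs CG; pose T := {X : lmodType R | C X}.
have [r [r0 rS]] : {r : nat -> T | r 0%N = exist _ G CG /\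
    forall n, step (@fgproj R) (sval (r n)) (sval (r n.+1))}.
  apply: (dependent_choice (R := fun X Y : T => step (@fgproj R) (sval X) (sval Y))).
  by move=> [X CX]; apply: cid; have [[Y [CY XY]] _] := Cs X CX; exists (exist _ Y CY).
have [l [l0 lS]] : {l : nat -> T | l 0%N = exist _ G CG /\
    forall n, step (@fgproj R) (sval (l n.+1)) (sval (l n))}.
  apply: (dependent_choice (R := fun X Y : T => step (@fgproj R) (sval Y) (sval X))).
  by move=> [X CX]; apply: cid; have [_ [Y [CY XY]]] := Cs X CX; exists (exist _ Y CY).
(* [Negz n] stands for -(n + 1), so the sequence [l] enters at n + 1 and its starting term G occurs
   only once. *)
pose Z (i : int) : lmodType R :=
  match i with Posz n => sval (r n) | Negz n => sval (l n.+1) end.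
have -> : G = Z 0 by rewrite /= r0.
apply: Gproj_chain => -[n|[|n]].
- by rewrite (_ : Posz n + 1 = Posz n.+1) //= -PoszD addn1.
- by rewrite (_ : Negz 0 + 1 = Posz 0) //= r0 -[G]/(sval (exist C G CG)) -l0.
- by rewrite (_ : Negz n.+1 + 1 = Negz n) //= !NegzE -addn1 PoszD opprD subrK.
Qed.


Lemma regular_fgproj : @fgproj R R^o.
Proof.
split; first by exists 1%N, (fun=> 1) => x; exists (fun=> x); rewrite big_ord1 [RHS]mulr1.
move=> M N g f gS; have [m mE] := gS (f 1).
have hL : linear (fun x : R^o => (x : R) *: m).
  by move=> a x y; rewrite scalerDl scalerA.
have [h hE] := linear_of hL; exists h => x.
by rewrite /= hE linearZ_LR /= mE -linearZ_LR [in RHS]/GRing.scale /= mulr1.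
Qed.

Lemma Gproj_stable : Gstable (@Gproj R).
Proof.
move=> G [P [d [Pfp dE Hd [iota [iI iE]]]]].
(* All kernels of one fixed complex form a stable class. So the neighbours of G in its complex are
   Gorenstein-projective too. *)
pose C X := exists (i : int) (j : {linear X -> P i}),
  injective j /\ forall x, d i x = 0 <-> exists y, j y = x.
have factor i X (j : {linear X -> P (i + 1)}) : injective j ->
    (forall x, d (i + 1) x = 0 <-> exists y, j y = x) ->
    exists p : {linear P i -> X}, surj p /\ forall x, j (p x) = d i x.
  move=> jI jE; have [x|p pE] := factor_inj (f := d i) jI.
    by apply/jE/dE; exists x.
  exists p; split=> // x; have /dE[y yE] : d (i + 1) (j x) = 0 by apply/jE; exists x.
  by exists y; apply: jI; rewrite pE.
have ext i X (j : {linear X -> P (i + 1 + 1)}) : injective j ->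
    (forall x, d (i + 1 + 1) x = 0 <-> exists y, j y = x) -> extends j R^o.
  move=> jI jE f; have [p [pS pE]] := factor _ _ _ jI jE.
  have [Rf Rp] := regular_fgproj; have [|g gE] := (Hd _ Rf Rp i (f \o p)).1.
    move=> x /=; rewrite (_ : p _ = 0) ?linear0 //; apply: jI; rewrite pE linear0.
    by apply/dE; exists x.
  by exists g => x; have [y <-] := pS x; rewrite pE -[RHS]/((f \o p) y) gE.
(* The maps of the complex live between [P i] and [P (i + 1)] as types, so an index must be put in
   the literal form k + 1 before a differential into that spot can be named. *)
have shift (i : int) : exists k, i = k + 1 by exists (i - 1); rewrite subrK.
have Cst : Gstable C.
  move=> X [i [j [jI jE]]]; split.
    have [K [k [kI kE]]] := kernelP (d (i + 1)).
    exists K; split; first by exists (i + 1), k.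
    have [p [pS pE]] := factor _ _ _ kI kE; exists (P i), j, p; split=> //.
      split=> // x; rewrite -jE -pE.
      by split=> [->|e]; [rewrite linear0 | apply: kI; rewrite linear0].
    have [i1 i1E] := shift i; have [i2 i2E] := shift i1.
    by move: j jI jE; rewrite i1E i2E; apply: ext.
  have [i1 i1E] := shift i; have [i2 i2E] := shift i1; have [i3 i3E] := shift i2.
  rewrite {}i1E {}i2E {}i3E {i i1 i2} in j jI jE *.
  have [K [k [kI kE]]] := kernelP (d (i3 + 1 + 1)).
  exists K; split; first by exists (i3 + 1 + 1), k.
  have [p [pS pE]] := factor _ _ _ jI jE; exists (P (i3 + 1 + 1)), k, p; split=> //.
    split=> // x; rewrite -kE -pE.
    by split=> [->|e]; [rewrite linear0 | apply: jI; rewrite linear0].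
  exact: ext.
have CG : C G by exists 0, iota.
have sub X : C X -> Gproj X by apply: Gstable_Gproj.
by have [[Y [/sub GY XY]] [K [/sub GK KX]]] := Cst G CG; split; [exists Y | exists K].
Qed.

Lemma Gproj_iso G (H : lmodType R) (f : {linear H -> G}) :
  injective f -> surj f -> Gproj G -> Gproj H.
Proof.
move=> fI fS [P [d [Pfp dE Hd [iota [iI iE]]]]]; exists P, d; split=> //.
exists (iota \o f); split=> [x y /iI/fI //|x]; rewrite iE.
split=> [[y <-]|[y <-]]; last by exists (f y).
by have [h <-] := fS y; exists h.
Qed.

(* The hypothesis on [k] says that Ext^1(G'', M) = 0. *)
Lemma extends_ses G' G G'' (j : {linear G' -> G}) (q : {linear G -> G''}) K P
    (k : {linear K -> P}) (r : {linear P -> G''}) M :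
  ses j q -> ses k r -> projective P -> extends k M -> extends j M.
Proof.
move=> [jI qS jE] [_ rS rE] Pp kx f.
have [s sE] := Pp _ _ q r qS.
have [t tE] : exists t : {linear K -> G'}, forall x, j (t x) = s (k x).
  apply: (factor_inj (f := s \o k)) => // x.
  by apply/jE; rewrite /= -[LHS]sE; apply/rE; exists x.
have [u uE] := kx (f \o t).
have [c cE] := copair_map j s.
have cS : surj c.
  move=> g; have [y yE] := rS (q g).
  have /jE[w wE] : q (g - s y) = 0 by rewrite linearB /= -[q (s y)]sE yE subrr.
  by exists (w, y); rewrite cE wE subrK.
(* [c] presents G as the quotient of G' x P by the pairs (- t w, k w), and [h] vanishes on these
   because [u] extends [f \o t]. *)
have [h hE] := copair_map f u.
have [g gE] : exists g : {linear G -> M}, forall x, g (c x) = h x.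
  apply: factor_surj => // -[x y]; rewrite cE hE => e.
  have /rE[w wE] : r y = 0.
    rewrite sE /=; apply: etrans (linear0 q); rewrite -e linearD (jE (j x)).2 ?add0r //.
    by exists x.
  have -> : x = - t w by apply: jI; rewrite linearN tE wE; apply/eqP; rewrite -addr_eq0 e.
  by rewrite -wE uE /= linearN addNr.
by exists g => x; have := gE (x, 0); rewrite cE hE !linear0 !addr0.
Qed.

(** The class of all such middle terms is stable by the two horseshoe lemmas. The right-hand one
    asks for Ext^1(G'', P') = 0, which follows from the step ending in G''. *)
Lemma Gproj_ext G' G G'' (j : {linear G' -> G}) (q : {linear G -> G''}) :
  ses j q -> Gproj G' -> Gproj G'' -> Gproj G.
Proof.
move=> jq G1 G2.
pose C X := exists G' G'' (j : {linear G' -> X}) (q : {linear X -> G''}),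
  [/\ ses j q, Gproj G' & Gproj G''].
apply: (Gstable_Gproj (C := C)); last by exists G', G'', j, q.
move=> {jq G1 G2 j q} {}G [{}G' [{}G'' [j [q [jq G1 G2]]]]].
have [[Y' [GY' [P' [i' [p' [Pp' ip' x']]]]]] [K' [GK' [Q' [k' [r' [Qp' kr' z']]]]]]] :=
  Gproj_stable G1.
have [[Y'' [GY'' [P'' [i'' [p'' [Pp'' ip'' x'']]]]]]
  [K'' [GK'' [Q'' [k'' [r'' [Qp'' kr'' z'']]]]]]] := Gproj_stable G2.
split.
  have jx := extends_ses jq kr'' Qp''.2 (extends_fgproj z'' Pp').
  have [Y [i [p [jY [qY [ip jqY x]]]]]] := horseshoe_right jq jx ip' ip'' x' x''.
  exists Y; split; first by exists Y', Y'', jY, qY.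
  exists (P' * P'')%type, i, p; split=> //.
  by split; [apply: fin_gen_prod Pp'.1 Pp''.1 | apply: projective_prod Pp'.2 Pp''.2].
have [K [i [p [jK [qK [ip jqK x]]]]]] := horseshoe_left jq Qp''.2 kr' kr'' z' z''.
exists K; split; first by exists K', K'', jK, qK.
exists (Q' * Q'')%type, i, p; split=> //.
by split; [apply: fin_gen_prod Qp'.1 Qp''.1 | apply: projective_prod Qp'.2 Qp''.2].
Qed.
End GorensteinProjective.

(** * Semi-Gorenstein-projective modules *)

Section Comparison.
Variables (R : pzRingType) (Z : lmodType R).

Lemma res_dd (P : proj_resolution Z) m x : res_d P m (res_d P m.+1 x) = 0.
Proof. by apply/res_exact; exists x. Qed.

Lemma res_lift (P Q : proj_resolution Z) m (f : {linear res_obj P m.+1 -> res_obj Q m.+1})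
    (f' : {linear res_obj P m -> res_obj Q m}) :
  (forall x, res_d Q m (f x) = f' (res_d P m x)) ->
  exists g : {linear res_obj P m.+2 -> res_obj Q m.+2},
    forall x, res_d Q m.+1 (g x) = f (res_d P m.+1 x).
Proof.
move=> ff'; apply: (projective_lift (f := f \o res_d P m.+1)); first exact: res_proj.
by move=> x; apply/res_exact; rewrite /= ff' res_dd linear0.
Qed.

Lemma res_lift0 (P Q : proj_resolution Z) :
  exists (f0 : {linear res_obj P 0 -> res_obj Q 0})
    (f1 : {linear res_obj P 1 -> res_obj Q 1}),
    (forall x, res_aug Q (f0 x) = res_aug P x) /\
    forall x, res_d Q 0 (f1 x) = f0 (res_d P 0 x).
Proof.
have [x|f0 f0E] := projective_lift (g := res_aug Q) (f := res_aug P) (@res_proj _ _ P 0).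
  exact: res_aug_surj.
have [x|f1 f1E] :=
    projective_lift (g := res_d Q 0) (f := f0 \o res_d P 0) (@res_proj _ _ P 1).
  by apply/res_exact0; rewrite /= f0E; apply/res_exact0; exists x.
by exists f0, f1.
Qed.

(* The lifts [f] and [g] of the identity of [Z] are homotopy inverse to each
   other on [P]; [s] and [t] are two consecutive components of the homotopy. *)
Lemma res_comparison (P Q : proj_resolution Z) m :
  exists (f' : {linear res_obj P m -> res_obj Q m})
    (f : {linear res_obj P m.+1 -> res_obj Q m.+1})
    (g' : {linear res_obj Q m -> res_obj P m})
    (g : {linear res_obj Q m.+1 -> res_obj P m.+1})
    (s : {linear res_obj P m.+1 -> res_obj P m.+2})
    (t : {linear res_obj P m -> res_obj P m.+1}),
    [/\ forall x, res_d Q m (f x) = f' (res_d P m x),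
        forall x, res_d P m (g x) = g' (res_d Q m x)
      & forall x, g (f x) - x = res_d P m.+1 (s x) + t (res_d P m x)].
Proof.
elim: m => [|m [f' [f [g' [g [s [t [ff' gg' H]]]]]]]].
  have [f' [f [f'E fE]]] := res_lift0 P Q; have [g' [g [g'E gE]]] := res_lift0 Q P.
  have [t tE] : exists t : {linear res_obj P 0 -> res_obj P 1},
      forall x, res_d P 0 (t x) = g' (f' x) - x.
    apply: (projective_lift (f := (g' \o f') \- idfun)); first exact: res_proj.
    by move=> x; apply/res_exact0; rewrite /= linearB /= g'E f'E subrr.
  have [s sE] : exists s : {linear res_obj P 1 -> res_obj P 2},
      forall x, res_d P 1 (s x) = g (f x) - x - t (res_d P 0 x).
    apply: (projective_lift (f := (g \o f) \- idfun \- (t \o res_d P 0))).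
      exact: res_proj.
    by move=> x; apply/res_exact; rewrite /= !linearB /= tE gE fE subrr.
  by exists f', f, g', g, s, t; split=> // x; rewrite sE subrK.
have [f2 f2E] := res_lift ff'; have [g2 g2E] := res_lift gg'.
have [r rE] : exists r : {linear res_obj P m.+2 -> res_obj P m.+3},
    forall x, res_d P m.+2 (r x) = g2 (f2 x) - x - s (res_d P m.+1 x).
  apply: (projective_lift (f := (g2 \o f2) \- idfun \- (s \o res_d P m.+1))).
    exact: res_proj.
  move=> x; apply/res_exact; rewrite /= !linearB /= g2E f2E.
  by rewrite H res_dd linear0 addr0 subrr.
by exists f, f2, g, g2, r, s; split=> // x; rewrite rE subrK.
Qed.

(** Passes from the one resolution provided by [Ext_vanishes] to any other: the cocycle is moved to
    Q along [g], where it is a coboundary, and moved back along [f']; the homotopy term [t] corrects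
    the difference. *)
Lemma Ext_vanishesE m (M : lmodType R) (P : proj_resolution Z) : Ext_vanishes m.+1 Z M ->
  forall c : {linear res_obj P m.+1 -> M}, cocycle c ->
  exists b : {linear res_obj P m -> M}, forall x, b (res_d P m x) = c x.
Proof.
move=> [Q vQ] c cP; have [f' [f [g' [g [s [t [ff' gg' H]]]]]]] := res_comparison P Q m.
have [g2 g2E] := res_lift gg'.
have [|b bE] := vQ (c \o g); first by move=> x; rewrite /= -g2E cP.
exists ((b \o f') \- (c \o t)) => x; rewrite /= -ff' -[b (res_d Q m _)]bE /=.
have -> : t (res_d P m x) = g (f x) - x - res_d P m.+1 (s x) by rewrite H addrC addKr.
by rewrite !(linearB c) cP subr0 opprB addrC subrK.
Qed.
End Comparison.

(** * Semi-Gorenstein-projective modules as a stable class *)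

Section SemiGorensteinProjective.
Variable R : pzRingType.
Implicit Types X Y Z K P L : lmodType R.

Section ChainResolution.
Variables (W P : nat -> lmodType R) (i : forall n, {linear W n.+1 -> P n})
  (p : forall n, {linear P n -> W n}).
Hypotheses (Pp : forall n, projective (P n)) (ip : forall n, ses (i n) (p n)).

Lemma chain_exact n x : (exists y, (i n \o p n.+1) y = x) <-> p n x = 0.
Proof.
have [_ _ ->] := ip n; have [_ pS _] := ip n.+1.
split=> [[y <-]|[k <-]]; first by exists (p n.+1 y).
by have [y <-] := pS k; exists y.
Qed.

Lemma chain_ker n x : (i n \o p n.+1) x = 0 <-> exists y, (i n.+1 \o p n.+2) y = x.
Proof.
rewrite chain_exact; have [iI _ _] := ip n.
by split=> [e|/= ->]; [apply: iI; rewrite linear0 | rewrite linear0].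
Qed.

Lemma chain_surj n : surj (p n).
Proof. by case: (ip n). Qed.

Definition chain_resolution : proj_resolution (W 0) :=
  @ProjResolution R (W 0%N) P (fun n => i n \o p n.+1) (p 0%N) Pp (@chain_surj 0%N)
    (fun x => iff_sym (chain_exact x)) chain_ker.
End ChainResolution.

Lemma chain_exists (C : lmodType R -> Prop) (S : lmodType R -> lmodType R -> Prop) Z :
  (forall X, C X -> exists Y, C Y /\ S Y X) -> C Z ->
  exists W : nat -> lmodType R, W 0%N = Z /\ forall n, S (W n.+1) (W n).
Proof.
move=> Cs CZ; pose T := {X : lmodType R | C X}.
have [r [r0 rS]] : {r : nat -> T | r 0%N = exist _ Z CZ /\
    forall n, S (sval (r n.+1)) (sval (r n))}.
  apply: (dependent_choice (R := fun X Y : T => S (sval Y) (sval X))).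
  by move=> [X CX]; apply: cid; have [Y [CY XY]] := Cs X CX; exists (exist _ Y CY).
by exists (fun n => sval (r n)); rewrite r0.
Qed.

(** In the resolution spliced from the steps, a cocycle in degree m + 1 descends to the syzygy
    [W m.+1], and the extension property of the step takes it to [P m]. *)
Lemma semistable_semi_Gproj (C : lmodType R -> Prop) Z :
  semistable C -> C Z -> semi_Gproj Z.
Proof.
move=> Cs CZ; have [W [W0 WS]] := chain_exists Cs CZ; case: _ / W0.
move: WS => /dep_choice[P /dep_choice[i /dep_choice[p E]]].
have Pp n : projective (P n) by case: (E n).
have ip n : ses (i n) (p n) by case: (E n).
move=> [//|m] _; exists (chain_resolution Pp ip) => c cP.
have [h hE] : exists h : {linear W m.+1 -> R^o}, forall x, h (p m.+1 x) = c x.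
  apply: factor_surj; first by case: (ip m.+1).
  by move=> x /(chain_exact ip)[y <-]; apply: cP.
by have [_ _ x] := E m; have [b bE] := x h; exists b => y; rewrite /= bE hE.
Qed.

Lemma resolution_exists Z : exists P : proj_resolution Z, True.
Proof.
have [|W [W0 WS]] := @chain_exists (fun=> True) (fun Y X => exists P
    (i : {linear Y -> P}) (p : {linear P -> X}), projective P /\ ses i p) Z _ I.
  move=> X _; have [P [p [Pp pS]]] := projective_cover X.
  by have [K [i ip]] := kernel_ses pS; exists K; split=> //; exists P, i, p.
case: _ / W0; move: WS => /dep_choice[P /dep_choice[i /dep_choice[p E]]].
by exists (chain_resolution (fun n => (E n).1) (fun n => (E n).2)).
Qed.

Section Splice.
Variables (K P Z : lmodType R) (i : {linear K -> P}) (p : {linear P -> Z}).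
Hypotheses (Pp : projective P) (ip : ses i p).
Variable Q : proj_resolution K.

(** Putting P in front of a resolution of K raises every degree by one; this is what makes dimension
    shifting work. *)
Definition splice_obj m : lmodType R := if m is m'.+1 then res_obj Q m' else P.
Definition splice_d m : {linear splice_obj m.+1 -> splice_obj m} :=
  match m with 0%N => i \o res_aug Q | m'.+1 => res_d Q m' end.
Lemma splice_proj m : projective (splice_obj m).
Proof. by case: m => [|m]; last exact: res_proj. Qed.
Lemma splice_surj : surj p. Proof. by case: ip. Qed.
Lemma splice_exact0 x : p x = 0 <-> exists y, splice_d 0 y = x.
Proof.
have [_ _ ->] := ip; split=> [[k <-]|[y <-]]; last by exists (res_aug Q y).
by have [y <-] := res_aug_surj Q k; exists y.
Qed.
Lemma splice_exact m x : splice_d m x = 0 <-> exists y, splice_d m.+1 y = x.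
Proof.
case: m x => [|m] x; last exact: res_exact.
rewrite -res_exact0; have [iI _ _] := ip.
by split=> [e|/= ->]; [apply: iI; rewrite linear0 | rewrite linear0].
Qed.
Definition splice : proj_resolution Z :=
  ProjResolution splice_proj splice_surj splice_exact0 splice_exact.
End Splice.

(** Dimension shifting: Ext^1 of Z gives the extension property, and Ext^(m+2) of Z gives Ext^(m+1)
    of K. *)
Lemma semi_Gproj_syzygy K P Z (i : {linear K -> P}) (p : {linear P -> Z}) :
  projective P -> ses i p -> semi_Gproj Z -> extends i R^o /\ semi_Gproj K.
Proof.
move=> Pp ip Zs; have [Q _] := resolution_exists K; split; last first.
  move=> [//|m] _; exists Q => c cP.
  have [//|b bE] := Ext_vanishesE (P := splice Pp ip Q) (Zs m.+2 isT) (c := c).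
  by exists b => x; rewrite -bE.
move=> f; have [|b bE] :=
    Ext_vanishesE (P := splice Pp ip Q) (Zs 1%N isT) (c := f \o res_aug Q).
  by move=> x; rewrite /= (_ : res_aug Q _ = 0) ?linear0 //; apply/res_exact0; exists x.
by exists b => x; have [y <-] := res_aug_surj Q x; rewrite -[RHS]bE.
Qed.

Lemma semi_Gproj_semistable : semistable (@semi_Gproj R).
Proof.
move=> Z Zs; have [P [p [Pp pS]]] := projective_cover Z.
have [K [i ip]] := kernel_ses pS; have [x Ks] := semi_Gproj_syzygy Pp ip Zs.
by exists K; split=> //; exists P, i, p.
Qed.

Lemma semi_Gproj_iso Z (H : lmodType R) (f : {linear Z -> H}) :
  injective f -> surj f -> semi_Gproj Z -> semi_Gproj H.
Proof.
move=> fI fS Zs; have [P [p [Pp pS]]] := projective_cover Z.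
have [K [i ip]] := kernel_ses pS; have [x Ks] := semi_Gproj_syzygy Pp ip Zs.
(* A single module is adjoined to the class by exhibiting one step, whose left term is already in
   the class. For H it is the cover of Z followed by [f]. *)
apply: (@semistable_semi_Gproj (fun X => semi_Gproj X \/ X = H)); last by right.
move=> X [Xs|->].
  by have [Y [Ys YX]] := semi_Gproj_semistable Xs; exists Y; split; first by left.
exists K; split; first by left.
exists P, i, (f \o p); split=> //; have [iI _ pE] := ip; split=> // [h|y].
  by have [z <-] := fS h; have [y <-] := pS z; exists y.
by rewrite -pE; split=> [e|/= ->]; [apply: fI; rewrite linear0 | rewrite linear0].
Qed.

Lemma semi_Gproj_ext X Y Z (j : {linear X -> Y}) (q : {linear Y -> Z}) :
  ses j q -> semi_Gproj X -> semi_Gproj Z -> semi_Gproj Y.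
Proof.
move=> jq Xs Zs; pose C Y := exists X Z (j : {linear X -> Y}) (q : {linear Y -> Z}),
  [/\ ses j q, semi_Gproj X & semi_Gproj Z].
apply: (semistable_semi_Gproj (C := C)); last by exists X, Z, j, q.
move=> {jq Xs Zs} {}Y [{}X [{}Z [{}j [{}q [jq Xs Zs]]]]].
have [K' [Ks' [P' [i' [p' [Pp' ip' x']]]]]] := semi_Gproj_semistable Xs.
have [K'' [Ks'' [P'' [i'' [p'' [Pp'' ip'' x'']]]]]] := semi_Gproj_semistable Zs.
have [K [i [p [jK [qK [ip jqK x]]]]]] := horseshoe_left jq Pp'' ip' ip'' x' x''.
exists K; split; first by exists K', K'', jK, qK.
by exists (P' * P'')%type, i, p; split=> //; apply: projective_prod.
Qed.

(** With P a cover of Y, the kernel L of P -> Y -> Z is an extension of X by the syzygy K of Y, so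
    it lies in the class. A map on L is extended to P in two stages: its restriction to K by the
    property of Y, the remainder, which descends to X, by the hypothesis on [j]. *)
Lemma semi_Gproj_coker X Y Z (j : {linear X -> Y}) (q : {linear Y -> Z}) :
  ses j q -> extends j R^o -> semi_Gproj X -> semi_Gproj Y -> semi_Gproj Z.
Proof.
move=> [jI qS qE] jx Xs Ys; have [P [p [Pp pS]]] := projective_cover Y.
have [K [k kp]] := kernel_ses pS; have [kx Ks] := semi_Gproj_syzygy Pp kp Ys.
have qpS : surj (q \o p).
  by move=> z; have [y <-] := qS z; have [x <-] := pS y; exists x.
have [L [l lqp]] := kernel_ses qpS; have [lI _ lE] := lqp; have [kI _ kE] := kp.
have [u uE] : exists u : {linear K -> L}, forall x, l (u x) = k x.
  by apply: factor_inj => // x; apply/lE; rewrite /= (ses0 kp) linear0.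
have [v vE] : exists v : {linear L -> X}, forall x, j (v x) = p (l x).
  by apply: (factor_inj (f := p \o l)) => // x; apply/qE; apply: (ses0 lqp).
have uv : ses u v.
  split=> [x y e|x|x]; first by apply: kI; rewrite -!uE e.
    have [y yE] := pS (j x).
    have /lE[z zE] : (q \o p) y = 0 by rewrite /= yE; apply/qE; exists x.
    by exists z; apply: jI; rewrite vE zE.
  split=> [e|[y <-]]; last by apply: jI; rewrite vE uE (ses0 kp) linear0.
  have /kE[y yE] : p (l x) = 0 by rewrite -vE e linear0.
  by exists y; apply: lI; rewrite uE.
have Ls := semi_Gproj_ext uv Ks Xs.
apply: (@semistable_semi_Gproj (fun X => semi_Gproj X \/ X = Z)); last by right.
move=> W [Ws|->].
  by have [V [Vs VW]] := semi_Gproj_semistable Ws; exists V; split; first by left.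
exists L; split; first by left.
exists P, l, (q \o p); split=> // f.
have [a aE] := kx (f \o u).
have [b bE] : exists b : {linear X -> R^o}, forall x, b (v x) = f x - a (l x).
  have [_ vS vuE] := uv; apply: (factor_surj (f := f \- (a \o l))) => // x /vuE[y <-].
  by rewrite /= uE aE subrr.
have [c cE] := jx b; exists (a \+ (c \o p)) => x.
by rewrite /= -vE cE bE addrC subrK.
Qed.
End SemiGorensteinProjective.

(** * Modules over triangular matrices *)

Section MatrixUnits.
Variables (A : pzRingType) (n : nat).
Local Notation T := ('T_n.+1(A)).
Implicit Types (i j k l : 'I_n.+1) (s t : T) (a b : A).

(* Rows and columns are numbered from the bottom right corner, to match the
   numbering of X_1, ..., X_n. *)
Definition ent t k l : A := t (rev_ord k) (rev_ord l).

Lemma ent_inj s t : (forall k l, ent s k l = ent t k l) -> s = t.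
Proof.
move=> st; apply: val_inj; apply/matrixP => k l.
by rewrite -[k]rev_ordK -[l]rev_ordK; apply: st.
Qed.

Lemma ent_gt t k l : (k < l)%N -> ent t k l = 0.
Proof. exact: tri_rev. Qed.

Definition mk_tri_mx (F : 'I_n.+1 -> 'I_n.+1 -> A) : 'M[A]_n.+1 :=
  \matrix_(r, c) (if (r <= c)%N then F (rev_ord r) (rev_ord c) else 0).
Lemma mk_tri_subproof F : mk_tri_mx F \in @utri A n.+1.
Proof. by apply/utriP => i j ji; rewrite mxE leqNgt ji. Qed.
Definition mk_tri F : T := Tri (mk_tri_subproof F).

Lemma ent_mk F k l : ent (mk_tri F) k l = if (l <= k)%N then F k l else 0.
Proof. by rewrite /ent /= mxE !rev_ordK /= leq_sub2lE ?ltnS // -ltnS. Qed.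

Lemma entM s t k l : ent (s * t) k l = \sum_m ent s k m * ent t m l.
Proof. by rewrite /ent mxE (reindex_inj rev_ord_inj). Qed.

Lemma entD s t k l : ent (s + t) k l = ent s k l + ent t k l.
Proof. by rewrite /ent mxE. Qed.

Lemma ent0 k l : ent 0 k l = 0.
Proof. by rewrite /ent mxE. Qed.

Lemma ent1 k l : ent 1 k l = (k == l)%:R.
Proof. by rewrite /ent mxE (inj_eq rev_ord_inj). Qed.

Lemma ent_sum (I : Type) (r : seq I) (P : pred I) (F : I -> T) k l :
  ent (\sum_(x <- r | P x) F x) k l = \sum_(x <- r | P x) ent (F x) k l.
Proof. exact: (big_morph (fun t => ent t k l) (fun s t => entD s t k l) (ent0 k l)). Qed.

(** A matrix unit from vertex i to vertex j. Since [mk_tri] discards the entries that are not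
    allowed, it is 0 for j < i, and several identities hold without an order condition. *)
Definition tu a j i : T := mk_tri (fun k l => if (k == j) && (l == i) then a else 0).

Lemma ent_tu a j i k l :
  ent (tu a j i) k l = if [&& (i <= j)%N, k == j & l == i] then a else 0.
Proof.
rewrite ent_mk; case: (k =P j) => [->|_] /=; last by rewrite andbF; case: ifP.
by case: (l =P i) => [->|_] /=; rewrite ?andbT ?andbF //; case: ifP.
Qed.

Lemma tuD a b j i : tu (a + b) j i = tu a j i + tu b j i.
Proof. by apply: ent_inj => k l; rewrite entD !ent_tu; case: ifP; rewrite ?addr0. Qed.

Lemma mul_tu a b j i k : (k <= i <= j)%N -> tu a j i * tu b i k = tu (a * b) j k.
Proof.
move=> /andP[ki ij]; apply: ent_inj => p q; rewrite entM ent_tu (leq_trans ki ij).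
rewrite (bigD1 i) //= big1 => [|m mi]; last first.
  by rewrite ent_tu (negbTE mi) !andbF mul0r.
rewrite !ent_tu eqxx ki ij /= addr0 !andbT.
by case: (p == j); case: (q == k); rewrite /= ?mul0r ?mulr0.
Qed.

Lemma tu_gt a j i : (j < i)%N -> tu a j i = 0.
Proof. by move=> ji; apply: ent_inj => p q; rewrite ent0 ent_tu leqNgt ji. Qed.

Lemma tu_mull a b j k : tu a j j * tu b j k = tu (a * b) j k.
Proof.
by case: (leqP k j) => [kj|jk]; [rewrite mul_tu ?kj ?leqnn | rewrite !(tu_gt _ jk) mulr0].
Qed.

Lemma tu_mulr a b j k : tu a j k * tu b k k = tu (a * b) j k.
Proof.
by case: (leqP k j) => [kj|jk]; [rewrite mul_tu ?kj ?leqnn | rewrite !(tu_gt _ jk) mul0r].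
Qed.

(** Row k is moved to row i. The entries with l > i, which [tu] would discard, are already 0 because
    k <= i. *)
Lemma tu_mul_expand i k t : (k <= i)%N -> tu 1 i k * t = \sum_l tu (ent t k l) i l.
Proof.
move=> ki; apply: ent_inj => p q; rewrite entM ent_sum (bigD1 k) //= big1 => [|m mk].
  rewrite [RHS](bigD1 q) //= [X in _ = _ + X]big1 => [|m mq]; last first.
    by rewrite ent_tu (eq_sym q) (negbTE mq) !andbF.
  rewrite !ent_tu ki !eqxx !andbT !addr0; case: (p =P i) => [pi|_] /=; last first.
    by rewrite mul0r andbF.
  rewrite mul1r andbT; case: ifP => // /negbT; rewrite -ltnNge => qi.
  by rewrite ent_gt // (leq_ltn_trans ki).
by rewrite ent_tu (negbTE mk) !andbF mul0r.
Qed.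

Lemma mul_tu_expand t a l j : (j <= l)%N ->
  t * tu a l j = \sum_k tu (ent t k l * a) k j.
Proof.
move=> jl; apply: ent_inj => p q; rewrite entM ent_sum (bigD1 l) //= big1 => [|m ml].
  rewrite [RHS](bigD1 p) //= [X in _ = _ + X]big1 => [|m mq]; last first.
    by rewrite ent_tu (eq_sym p) (negbTE mq) !andbF.
  rewrite !ent_tu jl !eqxx /= !addr0; case: (q =P j) => [_|_] /=; last first.
    by rewrite mulr0 andbF.
  rewrite andbT; case: ifP => // /negbT; rewrite -ltnNge => pj.
  by rewrite ent_gt ?mul0r // (leq_trans pj).
by rewrite ent_tu (negbTE ml) !andbF mulr0.
Qed.

Lemma sum_tu1 : \sum_k tu 1 k k = 1.
Proof.
apply: ent_inj => p q; rewrite ent_sum ent1 (bigD1 p) //= big1 => [|m mp].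
  by rewrite ent_tu leqnn eqxx addr0 /= eq_sym; case: ifP.
by rewrite ent_tu (eq_sym p) (negbTE mp) andbF.
Qed.
End MatrixUnits.

(** * Components of a module, cut out by diagonal idempotents *)

Section Component.
Variables (A : pzRingType) (n : nat) (k : 'I_n.+1) (Z : lmodType 'T_n.+1(A)).

Definition evp : {pred Z} := fun z => tu 1 k k *: z == z.
Lemma evp_zmod : zmod_closed evp.
Proof.
split; first by rewrite /in_mem /= /evp scaler0.
by move=> x y /eqP xE /eqP yE; rewrite /in_mem /= /evp scalerBr xE yE.
Qed.
HB.instance Definition _ := GRing.isZmodClosed.Build Z evp evp_zmod.
(* If Z is the column of X_n, ..., X_1, then [ev k Z] is X_(k+1), as the summand
   of Z cut out by a diagonal idempotent; [str j i Z] is the composite of the phi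
   from X_(i+1) to X_(j+1). *)
Record ev := Ev { ev_val : Z; _ : ev_val \in evp }.
HB.instance Definition _ := [isSub for ev_val].
HB.instance Definition _ := [Choice of ev by <:].
HB.instance Definition _ := [SubChoice_isSubZmodule of ev by <:].

Lemma ev_valK (x : ev) : tu 1 k k *: ev_val x = ev_val x.
Proof. by case: x => x /= /eqP. Qed.

Lemma pr_subproof i z : tu 1 k i *: z \in evp.
Proof. by apply/eqP; rewrite scalerA tu_mull mulr1. Qed.
Lemma ev_scale_subproof a (x : ev) : tu a k k *: ev_val x \in evp.
Proof. by apply/eqP; rewrite scalerA tu_mull mul1r. Qed.

(** The component of z at vertex i, carried to vertex k by the structure map; for i = k, the
    projection onto the component. *)
Definition pr (i : 'I_n.+1) z : ev := Ev (pr_subproof i z).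
Definition ev_scale a x : ev := Ev (ev_scale_subproof a x).

Lemma ev_scaleA a b x : ev_scale a (ev_scale b x) = ev_scale (a * b) x.
Proof. by apply: val_inj; rewrite /= scalerA tu_mull. Qed.
Lemma ev_scale1 : left_id 1 ev_scale.
Proof. by move=> x; apply: val_inj; apply: ev_valK. Qed.
Lemma ev_scaleDr : right_distributive ev_scale +%R.
Proof. by move=> a x y; apply: val_inj; rewrite /= scalerDr. Qed.
Lemma ev_scaleDl x : {morph ev_scale^~ x : a b / a + b}.
Proof. by move=> a b; apply: val_inj; rewrite /= tuD scalerDl. Qed.
HB.instance Definition _ := GRing.Zmodule_isLmodule.Build A ev
  ev_scaleA ev_scale1 ev_scaleDr ev_scaleDl.

Lemma ev_valZ a (x : ev) : ev_val (a *: x) = tu a k k *: ev_val x. Proof. by []. Qed.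
Lemma ev_valD (x y : ev) : ev_val (x + y) = ev_val x + ev_val y. Proof. by []. Qed.
Lemma ev_val0 : ev_val 0 = 0. Proof. by []. Qed.
Lemma ev_val_inj : injective ev_val. Proof. exact: val_inj. Qed.
Lemma ev_val_sum (I : Type) (r : seq I) (P : pred I) (F : I -> ev) :
  ev_val (\sum_(i <- r | P i) F i) = \sum_(i <- r | P i) ev_val (F i).
Proof. exact: (big_morph ev_val ev_valD ev_val0). Qed.

Lemma prK (x : ev) : pr k (ev_val x) = x.
Proof. by apply: val_inj; apply: ev_valK. Qed.
Lemma prD i x y : pr i (x + y) = pr i x + pr i y.
Proof. by apply: val_inj; rewrite /= scalerDr. Qed.
Lemma pr0 i : pr i 0 = 0.
Proof. by apply: val_inj; rewrite /= scaler0. Qed.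
Lemma pr_sum i (I : Type) (r : seq I) (P : pred I) (F : I -> Z) :
  pr i (\sum_(x <- r | P x) F x) = \sum_(x <- r | P x) pr i (F x).
Proof. exact: (big_morph (pr i) (prD i) (pr0 i)). Qed.

Lemma prZ (i : 'I_n.+1) (t : 'T_n.+1(A)) (z : Z) :
  (i <= k)%N -> pr i (t *: z) = \sum_l ent t i l *: pr l z.
Proof.
move=> ik; apply: ev_val_inj; rewrite ev_val_sum [LHS]scalerA tu_mul_expand // scaler_suml.
by apply: eq_bigr => l _; rewrite ev_valZ /= scalerA tu_mull mulr1.
Qed.
End Component.

Section Components.
Variables (A : pzRingType) (n : nat).
Local Notation T := ('T_n.+1(A)).
Implicit Types (i j k l : 'I_n.+1) (Z W K P Y : lmodType T).

Lemma str_linear j i Z : linear (fun x : ev i Z => pr j i (ev_val x)).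
Proof.
move=> a x y; apply: ev_val_inj.
by rewrite ev_valD ev_valZ /= scalerDr !scalerA tu_mulr tu_mull mul1r mulr1.
Qed.
Lemma str_exists j i Z :
  exists f : {linear ev i Z -> ev j Z}, forall x, f x = pr j i (ev_val x).
Proof. exact: linear_of (@str_linear j i Z). Qed.
Definition str j i Z : {linear ev i Z -> ev j Z} := sval (cid (str_exists j i Z)).
Lemma strE j i Z x : str j i Z x = pr j i (ev_val x).
Proof. exact: (svalP (cid (str_exists j i Z))). Qed.

Lemma evm_subproof k Z W (f : {linear Z -> W}) (x : ev k Z) :
  f (ev_val x) \in evp k (Z := W).
Proof. by apply/eqP; rewrite -linearZ_LR ev_valK. Qed.
Lemma evm_linear k Z W (f : {linear Z -> W}) :
  linear (fun x : ev k Z => Ev (evm_subproof f x)).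
Proof. by move=> a x y; apply: ev_val_inj; rewrite /= [LHS]linearP. Qed.
Lemma evm_exists k Z W (f : {linear Z -> W}) :
  exists g : {linear ev k Z -> ev k W}, forall x, ev_val (g x) = f (ev_val x).
Proof. by have [g gE] := linear_of (@evm_linear k Z W f); exists g => x; rewrite gE. Qed.
Definition evm k Z W (f : {linear Z -> W}) : {linear ev k Z -> ev k W} :=
  sval (cid (evm_exists k f)).
Lemma evmE k Z W (f : {linear Z -> W}) (x : ev k Z) : ev_val (evm k f x) = f (ev_val x).
Proof. exact: (svalP (cid (evm_exists k f))). Qed.

Lemma str_pr i j k Z (z : Z) : (k <= j <= i)%N -> str i j Z (pr j k z) = pr i k z.
Proof.
by move=> kji; apply: ev_val_inj; rewrite strE /= scalerA mul_tu // mulr1.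
Qed.
Lemma str_id k Z x : str k k Z x = x.
Proof. by rewrite strE prK. Qed.
Lemma str_str i j k Z x : (k <= j <= i)%N -> str i j Z (str j k Z x) = str i k Z x.
Proof. by move=> kji; rewrite [str j k Z x]strE str_pr // strE. Qed.
Lemma evm_pr k i Z W (f : {linear Z -> W}) z : evm k f (pr k i z) = pr k i (f z).
Proof. by apply: ev_val_inj; rewrite evmE /= linearZ_LR. Qed.
Lemma evm_str k i Z W (f : {linear Z -> W}) x :
  evm k f (str k i Z x) = str k i W (evm i f x).
Proof. by rewrite !strE evm_pr evmE. Qed.

Lemma ev_decomp Z (z : Z) : z = \sum_k ev_val (pr k k z).
Proof. by rewrite -[LHS]scale1r -sum_tu1 scaler_suml. Qed.

Lemma ev_sep Z (x y : Z) : (forall k, pr k k x = pr k k y) -> x = y.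
Proof.
by move=> xy; rewrite [x]ev_decomp [y]ev_decomp; apply: eq_bigr => k _; rewrite xy.
Qed.

Lemma evm_inj k Z W (f : {linear Z -> W}) : injective f -> injective (evm k f).
Proof. by move=> fI x y e; apply/ev_val_inj/fI; rewrite -!evmE e. Qed.
Lemma evm_surj k Z W (f : {linear Z -> W}) : surj f -> surj (evm k f).
Proof.
by move=> fS w; have [z zE] := fS (ev_val w); exists (pr k k z); rewrite evm_pr zE prK.
Qed.
Lemma evm_ses k K P Y (i : {linear K -> P}) (p : {linear P -> Y}) :
  ses i p -> ses (evm k i) (evm k p).
Proof.
move=> [iI pS pE]; split=> [||x]; [exact: evm_inj|exact: evm_surj|].
split=> [e|[y <-]].
  have /pE[y yE] : p (ev_val x) = 0 by rewrite -evmE e.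
  by exists (pr k k y); rewrite evm_pr yE prK.
by apply: ev_val_inj; rewrite !evmE; apply/pE; exists (ev_val y).
Qed.

Lemma fin_gen_fin (R : pzRingType) (M : lmodType R) (I : finType) (g : I -> M) :
  (forall x : M, exists c : I -> R, x = \sum_i c i *: g i) -> fin_gen M.
Proof.
move=> gE; exists #|I|, (g \o enum_val) => x; have [c ->] := gE x.
by exists (c \o enum_val); rewrite (reindex _ (onW_bij _ (@enum_val_bij I))).
Qed.

(** The components of the generators at all vertices, carried to k, generate: [prZ] reads a
    combination over T at vertex k. *)
Lemma ev_fin_gen k Z : fin_gen Z -> fin_gen (ev k Z).
Proof.
move=> [m [g gE]].
apply: (@fin_gen_fin _ _ ('I_m * 'I_n.+1)%type (fun p => pr k p.2 (g p.1))) => x.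
have [c cE] := gE (ev_val x); exists (fun p => ent (c p.1) k p.2).
rewrite -[LHS]prK cE pr_sum.
rewrite -(pair_bigA _ (fun s l => ent (c s) k l *: pr k l (g s))) /=.
apply: eq_bigr => s _.
exact: prZ.
Qed.
End Components.

(** * Interval modules and the maps into and out of them *)

Section IntervalModule.
Variables (A : pzRingType) (n a b : nat) (M : lmodType A).
Local Notation T := ('T_n.+1(A)).
Local Notation inI k := (a <= k <= b)%N.
Implicit Types (i j k l : 'I_n.+1) (s t : T).

Definition vmod_pred : {pred {ffun 'I_n.+1 -> M}} :=
  fun f => [forall k : 'I_n.+1, inI k || (f k == 0)].
Lemma vmod_predP (f : {ffun 'I_n.+1 -> M}) :
  reflect (forall k, ~~ inI k -> f k = 0) (f \in vmod_pred).
Proof.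
apply: (iffP forallP) => h k; first by move=> kI; have := h k; rewrite (negbTE kI) => /eqP.
by case: (boolP (inI k)) => //= kI; rewrite h.
Qed.
Lemma vmod_zmod : zmod_closed vmod_pred.
Proof.
split; first by apply/vmod_predP => k _; rewrite ffunE.
move=> f g /vmod_predP f0 /vmod_predP g0; apply/vmod_predP => k kI.
by rewrite !ffunE f0 // g0 // subrr.
Qed.
HB.instance Definition _ := GRing.isZmodClosed.Build _ vmod_pred vmod_zmod.

(* The representation M = ... = M on the vertices a, ..., b, and 0 elsewhere. *)
Record vmod := VMod { vmod_val : {ffun 'I_n.+1 -> M}; _ : vmod_val \in vmod_pred }.
HB.instance Definition _ := [isSub for vmod_val].
HB.instance Definition _ := [Choice of vmod by <:].
HB.instance Definition _ := [SubChoice_isSubZmodule of vmod by <:].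

Definition vco (f : vmod) k : M := vmod_val f k.

Lemma mk_vmod_subproof (F : 'I_n.+1 -> M) :
  [ffun k : 'I_n.+1 => if inI k then F k else 0] \in vmod_pred.
Proof. by apply/vmod_predP => k; rewrite ffunE => /negbTE ->. Qed.
Definition mk_vmod F : vmod := VMod (mk_vmod_subproof F).

Lemma vco_mk F k : vco (mk_vmod F) k = if inI k then F k else 0.
Proof. by rewrite /vco ffunE. Qed.
Lemma vco0E f k : ~~ inI k -> vco f k = 0.
Proof. by case: f => f fP; apply/vmod_predP. Qed.
Lemma vcoD f g k : vco (f + g) k = vco f k + vco g k.
Proof. by rewrite /vco ffunE. Qed.
Lemma vco0 k : vco 0 k = 0.
Proof. by rewrite /vco ffunE. Qed.
Lemma vco_inj f g : (forall k, inI k -> vco f k = vco g k) -> f = g.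
Proof.
move=> fg; apply/val_inj/ffunP => k; rewrite -[LHS]/(vco f k) -[RHS]/(vco g k).
by case: (boolP (inI k)) => kI; [apply: fg | rewrite !vco0E].
Qed.

Definition vscale t f : vmod := mk_vmod (fun k => \sum_l ent t k l *: vco f l).

Lemma vscaleA s t f : vscale s (vscale t f) = vscale (s * t) f.
Proof.
apply: vco_inj => k kI; rewrite !vco_mk kI.
under [RHS]eq_bigr => l _ do rewrite entM scaler_suml.
rewrite exchange_big; apply: eq_bigr => m _ /=.
under eq_bigr => l _ do rewrite -scalerA.
(* Truncating at an intermediate vertex m outside the interval loses nothing: for m < a the entries
   of [t] from the interval to m vanish, and for m > b the entry of [s] from m to k does. *)
rewrite -scaler_sumr vco_mk; case: ifP => // /negbT; rewrite negb_and -!ltnNge.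
case/orP=> [ma|bm].
  congr (_ *: _); rewrite big1 // => l _; case: (boolP (inI l)) => [/andP[al _]|lI].
    by rewrite ent_gt ?scale0r // (leq_trans ma).
  by rewrite vco0E ?scaler0.
by have /andP[_ kb] := kI; rewrite ent_gt ?scale0r // (leq_ltn_trans kb).
Qed.

Lemma vscale1 : left_id 1 vscale.
Proof.
move=> f; apply: vco_inj => k kI; rewrite vco_mk kI (bigD1 k) //= big1 => [|l lk].
  by rewrite ent1 eqxx scale1r addr0.
by rewrite ent1 eq_sym (negbTE lk) scale0r.
Qed.

Lemma vscaleDr : right_distributive vscale +%R.
Proof.
move=> t f g; apply: vco_inj => k kI; rewrite vcoD !vco_mk kI -big_split.
by apply: eq_bigr => l _; rewrite vcoD scalerDr.
Qed.

Lemma vscaleDl f : {morph vscale^~ f : s t / s + t}.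
Proof.
move=> s t; apply: vco_inj => k kI; rewrite vcoD !vco_mk kI -big_split.
by apply: eq_bigr => l _; rewrite entD scalerDl.
Qed.
HB.instance Definition _ := GRing.Zmodule_isLmodule.Build T vmod
  vscaleA vscale1 vscaleDr vscaleDl.

Lemma vcoZ t f k : inI k -> vco (t *: f) k = \sum_l ent t k l *: vco f l.
Proof. by move=> kI; rewrite [vco _ _]vco_mk kI. Qed.

Lemma vco_tu c f i k : inI k -> (i <= k)%N -> vco (tu c k i *: f) k = c *: vco f i.
Proof.
move=> kI ik; rewrite vcoZ // (bigD1 i) //= big1 => [|l li].
  by rewrite ent_tu ik !eqxx addr0.
by rewrite ent_tu (negbTE li) !andbF scale0r.
Qed.

Variable Z : lmodType T.

Definition kills (c : nat) i (f : {linear ev i Z -> M}) : Prop :=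
  forall k, (k < c)%N -> forall x, f (str i k Z x) = 0.

(** The structure maps inside the interval are identities, so a map into the interval module is
    determined by its component at the last vertex. The zeros below [a] account for the condition
    [kills a f]. *)
Lemma hom_vmod i (f : {linear ev i Z -> M}) : b = i -> kills a f ->
  exists F : {linear Z -> vmod}, forall z k, inI k -> vco (F z) k = f (pr i k z).
Proof.
move=> bi fa; pose F z := mk_vmod (fun k => f (pr i k z)).
have FE z k : inI k -> vco (F z) k = f (pr i k z) by rewrite vco_mk => ->.
have FL : linear F.
  move=> t x y; apply: vco_inj => k kI; rewrite vcoD vcoZ // !FE // prD linearD.
  congr (_ + _); have /andP[_ kb] := kI; rewrite prZ -?bi // linear_sum.
  apply: eq_bigr => l _; rewrite linearZ_LR; case: (boolP (inI l)) => lI.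
    by rewrite FE.
  rewrite vco0E //; have : (l < a)%N || (b < l)%N by rewrite !ltnNge -negb_and.
  case/orP=> [la|bl]; last by rewrite ent_gt ?scale0r // (leq_ltn_trans kb).
  case: (leqP l i) => [li|il].
    by rewrite -(@str_pr _ _ i l l) ?leqnn // fa // scaler0.
  by rewrite ent_gt ?scale0r // (leq_ltn_trans kb) // bi.
by have [F' F'E] := linear_of FL; exists F' => z k kI; rewrite F'E FE.
Qed.

Lemma vmod_hom i (F : {linear Z -> vmod}) : inI i ->
  exists f : {linear ev i Z -> M}, forall x, f x = vco (F (ev_val x)) i.
Proof.
move=> iI; have fL : linear (fun x : ev i Z => vco (F (ev_val x)) i).
  by move=> c x y; rewrite ev_valD ev_valZ linearD linearZ_LR vcoD vco_tu.
by have [f fE] := linear_of fL; exists f.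
Qed.

Lemma vmod_hom_str i k (F : {linear Z -> vmod}) (x : ev k Z) : inI i -> (k <= i)%N ->
  vco (F (ev_val (str i k Z x))) i = vco (F (ev_val x)) k.
Proof. by move=> iI ki; rewrite strE linearZ_LR vco_tu // scale1r. Qed.

End IntervalModule.

Section IntervalMaps.
Variables (A : pzRingType) (n : nat).
Local Notation T := ('T_n.+1(A)).
Implicit Types (i j k l : 'I_n.+1) (s t : T) (M N Q : lmodType A) (Z P : lmodType T).

Lemma vmod_map a b M N (g : {linear M -> N}) :
  exists G : {linear vmod n a b M -> vmod n a b N}, forall x k, vco (G x) k = g (vco x k).
Proof.
pose G (x : vmod n a b M) : vmod n a b N := mk_vmod a b (fun k => g (vco x k)).
have GE x k : vco (G x) k = g (vco x k).
  by rewrite vco_mk; case: ifP => // /negbT kI; rewrite vco0E // linear0.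
have GL : linear G.
  move=> t x y; apply: vco_inj => k kI; rewrite vcoD vcoZ // !GE vcoD vcoZ // linearD.
  by rewrite linear_sum; congr (_ + _); apply: eq_bigr => l _; rewrite linearZ_LR GE.
by have [G' G'E] := linear_of GL; exists G' => x k; rewrite G'E GE.
Qed.

Lemma vmod_map_surj a b M N (g : {linear M -> N})
    (G : {linear vmod n a b M -> vmod n a b N}) :
  (forall x k, vco (G x) k = g (vco x k)) -> surj g -> surj G.
Proof.
move=> GE /choice[s sE] y; exists (mk_vmod a b (fun k => s (vco y k))).
by apply: vco_inj => k kI; rewrite GE vco_mk kI.
Qed.

Lemma vmod_restrict b c M : (b <= c)%N ->
  exists G : {linear vmod n 0 c M -> vmod n 0 b M},
    surj G /\ forall x k, (k <= b)%N -> vco (G x) k = vco x k.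
Proof.
move=> bc; pose G (x : vmod n 0 c M) : vmod n 0 b M := mk_vmod 0 b (vco x).
have GE x k : (k <= b)%N -> vco (G x) k = vco x k by rewrite vco_mk => ->.
have GL : linear G.
  move=> t x y; apply: vco_inj => k kb; rewrite vcoD vcoZ // !GE //.
  rewrite vcoD vcoZ ?(leq_trans kb) //.
  congr (_ + _); apply: eq_bigr => l _; case: (leqP l b) => [lb|bl]; first by rewrite GE.
  by rewrite ent_gt ?scale0r // (leq_ltn_trans kb).
have [G' G'E] := linear_of GL; exists G'; split=> [y|x k kb]; last by rewrite G'E GE.
exists (mk_vmod 0 c (vco y)); apply: vco_inj => k kb.
by rewrite G'E GE // vco_mk (leq_trans kb).
Qed.

(** Maps on the component at i that kill what comes from below [a] correspond to maps into interval
    modules on a, ..., i. The lift is taken there, which keeps the vanishing condition. *)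
Lemma projective_ev_lift a i P M N (g : {linear M -> N}) (f : {linear ev i P -> N}) :
  (a <= i)%N -> projective P -> surj g -> kills a f ->
  exists h : {linear ev i P -> M}, kills a h /\ forall x, g (h x) = f x.
Proof.
move=> ai Pp gS fa; have [F FE] := hom_vmod (erefl (val i)) fa.
have [G GE] := vmod_map a i g; have [H HE] := Pp _ _ G F (vmod_map_surj GE gS).
have iI : (a <= i <= i)%N by rewrite ai leqnn.
have [h hE] := vmod_hom H iI; exists h; split=> [k ka x|x].
  rewrite hE vmod_hom_str ?vco0E // -?ltnNge ?(leq_trans (ltnW ka)) //.
  by rewrite negb_and -ltnNge ka.
by rewrite hE -GE -[G _]HE FE // prK.
Qed.

Lemma ev_projective i P : projective P -> projective (ev i P).
Proof.
move=> Pp M N g f gS; have [//|h [_ hE]] := projective_ev_lift (leq0n i) Pp gS (f := f).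
by exists h => x; rewrite /= hE.
Qed.

(** By [hom_vmod], [f] gives a map from P to the interval module on 0, ..., i, a quotient of the one
    on 0, ..., n. A lift to the latter, read at [top], extends [f]. *)
Lemma str_extends i P M : projective P -> extends (str ord_max i P) M.
Proof.
move=> Pp f; have f0 : kills 0 f by [].
have [F FE] := hom_vmod (erefl (val i)) f0.
have [G [GS GE]] := vmod_restrict M (leq_ord i); have [H HE] := Pp _ _ G F GS.
have [|g gE] := vmod_hom (i := ord_max) H; first by rewrite leqnn.
exists g => x; rewrite gE vmod_hom_str ?leqnn ?leq_ord // -GE // -[G _]HE FE //.
  by rewrite prK.
by rewrite leqnn.
Qed.

(** The identity of the component at k extends along the map to [top], giving a retraction; and that
    map factors through vertex i. *)
Lemma projective_str_inj i k P : projective P -> (k <= i)%N -> injective (str i k P).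
Proof.
move=> Pp ki; have [r rE] := str_extends Pp (idfun : {linear ev k P -> ev k P}).
apply: subker_inj => x /(congr1 (str ord_max i P)).
by rewrite str_str ?ki ?leq_ord // => /(congr1 r); rewrite rE !linear0.
Qed.

Definition vbase (j : 'I_n.+1) Q (q : Q) : vmod n j n Q :=
  mk_vmod j n (fun k => if k == j then q else 0).

Lemma vbase_expand j Q (x : vmod n j n Q) :
  x = \sum_(k : 'I_n.+1) tu 1 k j *: vbase j (vco x k).
Proof.
apply: vco_inj => k kI.
rewrite (big_morph (fun x => vco x k) (fun x y => vcoD x y k) (vco0 _ _ _ k)).
rewrite (bigD1 k) //= big1 => [|l lk].
  have /andP[jk _] := kI.
  by rewrite vco_tu // vco_mk leqnn leq_ord eqxx scale1r addr0.
by rewrite vcoZ // big1 // => m _; rewrite ent_tu (eq_sym k) (negbTE lk) andbF scale0r.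
Qed.

Lemma vbase_linear j Q a (x y : Q) :
  vbase j (a *: x + y) = tu a j j *: vbase j x + vbase j y.
Proof.
apply: vco_inj => k kI; rewrite vcoD vcoZ // (bigD1 j) //= big1 => [|l lj].
  rewrite !vco_mk kI leqnn leq_ord ent_tu !eqxx leqnn andbT addr0 /=.
  by case: ifP => _; rewrite ?scale0r ?addr0.
by rewrite ent_tu (negbTE lj) !andbF scale0r.
Qed.

Lemma vbase_ev j Q : exists e : {linear Q -> ev j (vmod n j n Q)},
  forall q, ev_val (e q) = vbase j q.
Proof.
have eP q : vbase j q \in evp j (Z := vmod n j n Q).
  apply/eqP; have := vbase_linear j 1 q 0; rewrite scale1r !addr0 => {2}->.
  suff -> : vbase j (0 : Q) = 0 by rewrite addr0.
  by apply: vco_inj => k kI; rewrite vco_mk kI vco0 if_same.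
have eL : linear (fun q => Ev (eP q)).
  by move=> a x y; apply: ev_val_inj; rewrite /= [LHS]vbase_linear.
by have [e eE] := linear_of eL; exists e => q; rewrite eE.
Qed.

Lemma vmod_ext j Q Z (f g : {linear vmod n j n Q -> Z}) :
  (forall q, f (vbase j q) = g (vbase j q)) -> f =1 g.
Proof.
move=> fg x; rewrite [x]vbase_expand !linear_sum; apply: eq_bigr => k _.
by rewrite !linearZ_LR fg.
Qed.

(** The interval module on j, ..., n is induced from Q at vertex j: inducing is left adjoint to
    taking the component at j. *)
Lemma vmod_lift j Q Z (h : {linear Q -> ev j Z}) :
  exists H : {linear vmod n j n Q -> Z},
    (forall q, H (vbase j q) = ev_val (h q)) /\
    forall x, H x = \sum_(k : 'I_n.+1) tu 1 k j *: ev_val (h (vco x k)).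
Proof.
pose H (x : vmod n j n Q) := \sum_(k : 'I_n.+1) tu 1 k j *: ev_val (h (vco x k)).
have HL : linear H.
  move=> t x y; rewrite /H.
  transitivity (\sum_(k : 'I_n.+1) tu 1 k j *: ev_val (h (vco (t *: x) k)) +
      \sum_(k : 'I_n.+1) tu 1 k j *: ev_val (h (vco y k))).
    by rewrite -big_split; apply: eq_bigr => k _ /=; rewrite vcoD linearD ev_valD scalerDr.
  congr (_ + _); rewrite scaler_sumr.
  transitivity (\sum_(k : 'I_n.+1) \sum_l tu (ent t k l) k j *: ev_val (h (vco x l))).
    apply: eq_bigr => k _; case: (leqP j k) => [jk|kj]; last first.
      by rewrite tu_gt // scale0r big1 // => l _; rewrite tu_gt // scale0r.
    rewrite vcoZ ?jk ?leq_ord // linear_sum ev_val_sum scaler_sumr; apply: eq_bigr => l _.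
    by rewrite linearZ_LR ev_valZ scalerA mul_tu ?leqnn // mul1r.
  rewrite exchange_big; apply: eq_bigr => l _ /=; case: (leqP j l) => [jl|lj].
    rewrite scalerA mul_tu_expand // scaler_suml; apply: eq_bigr => k _.
    by rewrite mulr1.
  rewrite [tu 1 l j]tu_gt // scale0r scaler0 big1 // => k _.
  by rewrite vco0E ?linear0 ?ev_val0 ?scaler0 // negb_and -ltnNge lj.
have [H' H'E] := linear_of HL; exists H'; split=> [q|x]; last exact: H'E.
rewrite H'E /H (bigD1 j) //= big1 => [|k kj].
  by rewrite vco_mk leqnn leq_ord eqxx addr0 ev_valK.
by rewrite vco_mk (negbTE kj) if_same linear0 ev_val0 scaler0.
Qed.

(** A left adjoint preserves projectives when its right adjoint, here the component at j, preserves
    surjections. *)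
Lemma vmod_projective j Q : projective Q -> projective (vmod n j n Q).
Proof.
move=> Qp M N g f gS; have [e eE] := vbase_ev j Q.
have [h hE] := Qp _ _ (evm j g) (evm j f \o e) (evm_surj gS).
have [H [HE _]] := vmod_lift h; exists H.
by apply: (@vmod_ext _ _ _ f (g \o H)) => q; rewrite /= HE -evmE -[evm j g _]hE /= evmE eE.
Qed.

Lemma vmod_fin_gen j Q : fin_gen Q -> fin_gen (vmod n j n Q).
Proof.
move=> [m [g gE]]; exists m, (fun s : 'I_m => vbase j (g s)) => x.
have [c cE] := choice (fun k => gE (vco x k)).
exists (fun s : 'I_m => \sum_(k : 'I_n.+1) tu (c k s) k j).
have [e eE] := vbase_ev j Q.
rewrite [LHS]vbase_expand; under [RHS]eq_bigr => s _ do rewrite scaler_suml.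
rewrite exchange_big; apply: eq_bigr => k _ /=.
rewrite -eE cE linear_sum ev_val_sum scaler_sumr; apply: eq_bigr => s _.
by rewrite linearZ_LR ev_valZ eE scalerA tu_mulr mul1r.
Qed.
End IntervalMaps.

(** * (Semi-)Gorenstein-projective modules over triangular matrices *)

Section TriangularExtensions.
Variables (A : pzRingType) (n : nat).
Local Notation T := ('T_n.+1(A)).
Local Notation top := (@ord_max n).
Implicit Types (i j k l : 'I_n.+1) (s t : T) (M N Q C D : lmodType A).
Implicit Types (X Y Z K P : lmodType T).

Lemma kills_succ b i Z M (f : {linear ev b Z -> M}) : (i <= b)%N ->
  (forall x, f (str b i Z x) = 0) -> kills i.+1 f.
Proof.
move=> ib f0 k; rewrite ltnS => ki x.
have <- : str b i Z (str i k Z x) = str b k Z x by rewrite str_str ?ki.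
exact: f0.
Qed.

(** Column j of T is a copy of the interval module of A on j, ..., n, so a map into it is determined
    by its entry in row [top]; the zero entries (k, j) with k < j give the vanishing condition. *)
Lemma hom_entry Z (F : {linear Z -> T^o}) j :
  exists g : {linear ev top Z -> A^o},
    kills j g /\ forall z k, g (pr top k z) = ent (F z : T) k j.
Proof.
have gL : linear (fun x : ev top Z => ent (F (ev_val x) : T) top j : A^o).
  move=> a x y; rewrite ev_valD ev_valZ linearD linearZ_LR entD; congr (_ + _).
  rewrite [LHS](entM (tu a top top) (F (ev_val x) : T)) (bigD1 top) //= big1 => [|m mt].
    by rewrite ent_tu leqnn !eqxx addr0.
  by rewrite ent_tu (negbTE mt) !andbF mul0r.
have [g gE] := linear_of gL; exists g.
have gp z k : g (pr top k z) = ent (F z : T) k j.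
  rewrite gE /= linearZ_LR.
  rewrite [LHS](entM (tu 1 top k) (F z : T)) (bigD1 k) //= big1 => [|m mk].
    by rewrite ent_tu leq_ord !eqxx addr0 mul1r.
  by rewrite ent_tu (negbTE mk) !andbF mul0r.
by split=> // k kj x; rewrite strE gp ent_gt.
Qed.

Lemma hom_of_entries Z (g : 'I_n.+1 -> {linear ev top Z -> A^o}) :
  (forall j, kills j (g j)) ->
  exists F : {linear Z -> T^o}, forall z k j, ent (F z : T) k j = g j (pr top k z).
Proof.
move=> gk; pose F z : T^o := mk_tri (fun k j => g j (pr top k z) : A).
have FE z k j : ent (F z : T) k j = g j (pr top k z).
  rewrite ent_mk; case: leqP => // kj.
  by rewrite -(@str_pr _ _ top k k) ?leqnn ?leq_ord // gk.
have FL : linear F.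
  move=> t x y; apply: ent_inj => k j; rewrite entD [X in _ = X + _]entM !FE prD linearD.
  rewrite prZ ?leq_ord // linear_sum; congr (_ + _); apply: eq_bigr => l _.
  by rewrite linearZ_LR FE.
by have [F' F'E] := linear_of FL; exists F' => z k j; rewrite F'E FE.
Qed.

Lemma extends_regularP X P (a : {linear X -> P}) :
  extends a T^o <-> forall j (g : {linear ev top X -> A^o}), kills j g ->
    exists h : {linear ev top P -> A^o}, kills j h /\ forall x, h (evm top a x) = g x.
Proof.
split=> [ax j g gj|ax F].
  (* The map into T whose only nonzero column is column j, given by [g]. *)
  pose g_ l : {linear ev top X -> A^o} := if l == j then g else \0.
  have [|F FE] := hom_of_entries (g := g_).
    by move=> l; rewrite /g_; case: eqP => [->|_].
  have [H HE] := ax F; have [h [hk hE]] := hom_entry H j; exists h; split=> // x.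
  have Ex : g x = ent (F (ev_val x) : T) top j by rewrite FE /g_ eqxx prK.
  by rewrite Ex -HE -evmE -hE prK.
have [g gE] := choice (hom_entry F).
have [h hE] := choice (fun j => ax j (g j) (gE j).1).
have [H HE] := hom_of_entries (fun j => (hE j).1); exists H => x.
by apply: ent_inj => k j; rewrite HE -evm_pr (hE j).2 (gE j).2.
Qed.

(* The dual X_n^* -> X_i^* of each composite of the phi is surjective. *)
Definition dual_onto Z : Prop := forall i, extends (str top i Z) A^o.

Lemma extends_str_top i Z M : (n <= i)%N -> extends (str top i Z) M.
Proof.
move=> ni; have -> : i = top by apply/val_inj/eqP; rewrite eqn_leq leq_ord.
by move=> f; exists f => x; rewrite str_id.
Qed.

Lemma dual_ontoP Z : dual_onto Z <-> forall (i : nat) (h : (i.+1 < n.+1)%N),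
  extends (str (Ordinal h) (Ordinal (ltnW h)) Z) A^o.
Proof.
split=> [Zd i h f|Zd i].
  have [g gE] := Zd (Ordinal (ltnW h)) f; exists (g \o str top (Ordinal h) Z) => x.
  by rewrite /= str_str /= ?leqnSn ?leq_ord // gE.
(* Induction on the distance to the last vertex: extend one step up, then all the way to [top]. *)
move: {2}(n - i)%N (leqnn (n - i)) => m; elim: m i => [|m IH] i im f.
  by apply: extends_str_top; rewrite -subn_eq0 -leqn0.
case: (ltnP i n) => [lin|ni]; last exact: extends_str_top.
have h : (i.+1 < n.+1)%N by [].
have ei : Ordinal (ltnW h) = i by apply: val_inj.
have := Zd i h; rewrite ei => /(_ f)[g gE].
have [|u uE] := IH (Ordinal h) _ g; first by rewrite /= subnS -ltnS prednK ?subn_gt0.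
by exists u => x; rewrite -gE -uE str_str /= ?leqnSn ?leq_ord.
Qed.

(** Pull [f] back to P and extend it to [u] at [top]. On K, [u] kills everything coming from
    vertices up to i, so it extends to some [v] on P with the same vanishing. Then [u - v] descends
    to Z, and it restricts to [f] because [v] is 0 on what comes from i. *)
Lemma step_dual_onto (c : lmodType T -> Prop) K Z :
  (forall P, c P -> projective P) -> step c K Z -> dual_onto Z.
Proof.
move=> cp [P [a [p [/cp Pp ap /extends_regularP ax]]]] i f.
case: (ltnP i n) => [lin|ni]; last exact: extends_str_top.
have [u uE] := str_extends Pp (f \o evm i p).
have i1 : (i.+1 < n.+1)%N by [].
have [|v [vk vE]] := ax (Ordinal i1) (u \o evm top a).
  apply: (@kills_succ top i) => [|x]; first exact: leq_ord.
  by rewrite /= evm_str uE /= (ses0 (evm_ses i ap)) linear0.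
have [_ pS pE] := evm_ses top ap; have [_ pSi _] := evm_ses i ap.
have [w wE] : exists w : {linear ev top Z -> A^o}, forall x, w (evm top p x) = u x - v x.
  by apply: (factor_surj (f := u \- v)) => // x /pE[y <-]; rewrite /= vE subrr.
exists w => x; have [y <-] := pSi x.
by rewrite -evm_str wE uE vk //= subr0.
Qed.

Lemma step_ev (c : lmodType T -> Prop) (d : lmodType A -> Prop) X Y i :
  (forall P, c P -> d (ev i P)) ->
  step c X Y -> dual_onto X -> step d (ev i X) (ev i Y).
Proof.
move=> cd [P [a [p [/cd Pd ap /extends_regularP ax]]]] Xd.
exists (ev i P), (evm i a), (evm i p); split=> //; first exact: evm_ses.
(* Column 0 of T carries no vanishing condition, so any functional at [top] extends from X to P. *)
move=> f; have [g gE] := Xd i f; have [//|h [_ hE]] := ax ord0 g.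
by exists (h \o str top i P) => x; rewrite /= -evm_str hE gE.
Qed.

Lemma semi_Gproj_dual_onto Z : semi_Gproj Z -> dual_onto Z.
Proof.
by move=> Zs; have [K [_ KZ]] := semi_Gproj_semistable Zs; apply: step_dual_onto KZ.
Qed.

Lemma semi_Gproj_ev Z i : semi_Gproj Z -> semi_Gproj (ev i Z).
Proof.
move=> Zs; pose C M := exists Z, semi_Gproj Z /\ M = ev i Z.
apply: (semistable_semi_Gproj (C := C)); last by exists Z.
move=> _ [{Zs}Z [/semi_Gproj_semistable[K [Ks KZ]] ->]].
exists (ev i K); split; first by exists K.
apply: step_ev KZ _; last exact: semi_Gproj_dual_onto.
by move=> P; apply: ev_projective.
Qed.

Lemma semi_GprojP Z :
  semi_Gproj Z <-> dual_onto Z /\ forall i, semi_Gproj (ev i Z).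
Proof.
split=> [Zs|[Zd Zs]].
  by split=> [|i]; [apply: semi_Gproj_dual_onto | apply: semi_Gproj_ev].
pose C Z := dual_onto Z /\ forall i, semi_Gproj (ev i Z).
apply: (semistable_semi_Gproj (C := C)) => // {Zd Zs}Z [Zd Zs].
have [P [p [Pp pS]]] := projective_cover Z; have [K [a ap]] := kernel_ses pS.
have KE i := semi_Gproj_syzygy (ev_projective (i := i) Pp) (evm_ses i ap) (Zs i).
exists K; split.
  split=> [i f|i]; last by case: (KE i).
  have [g gE] := (KE i).1 f; have [h hE] := str_extends Pp g.
  by exists (h \o evm top a) => x; rewrite /= evm_str hE gE.
exists P, a, p; split=> //; apply/extends_regularP => j g gj.
(* The extension [h] need not kill what comes from vertices below j. For i = j - 1 its restriction
   to the component of P at i vanishes on K, so it descends to Z; extended to [top] by [Zd], it is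
   the correction [v] to subtract. For j = 0 nothing has to be killed. *)
have [h hE] := (KE top).1 g.
case: j gj => -[|m] mn gj; first by exists h.
have im : (m < n.+1)%N by apply: ltnW.
pose i := Ordinal im; have [_ pSi pE] := evm_ses i ap.
have [u uE] : exists u : {linear ev i Z -> A^o},
    forall x, u (evm i p x) = h (str top i P x).
  apply: (factor_surj (f := h \o str top i P)) => // x /pE[y <-].
  by rewrite /= -evm_str hE gj //=.
have [v vE] := Zd i u; exists (h \- (v \o evm top p)); split=> [|x].
  apply: (@kills_succ top i) => [|x]; first exact: leq_ord.
  by rewrite /= evm_str vE uE subrr.
by rewrite /= hE (ses0 (evm_ses top ap)) linear0 subr0.
Qed.

(** * Cokernels of consecutive structure maps *)

Section CokernelStep.
Variables (i : nat) (h : (i.+1 < n.+1)%N).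
Local Notation lo := (Ordinal (ltnW h)).
Local Notation hi := (Ordinal h).

(** Maps out of the cokernel are maps on the component at [hi] that kill all lower vertices, and
    [projective_ev_lift] lifts these with their vanishing. *)
Lemma coker_fgproj P C (r : {linear ev hi P -> C}) :
  fgproj P -> ses (str hi lo P) r -> fgproj C.
Proof.
move=> [Pf Pp] [_ rS rE]; split; first exact: fin_gen_surj rS (ev_fin_gen hi Pf).
move=> M N g f gS; have frk : kills i.+1 (f \o r).
  apply: (@kills_succ hi lo) => [|x]; first exact: leqnSn.
  by rewrite /= (rE _).2 ?linear0 //; exists x.
have [u [uk uE]] := projective_ev_lift (leqnn i.+1 : (i.+1 <= hi)%N) Pp gS frk.
have [v vE] : exists v : {linear C -> M}, forall x, v (r x) = u x.
  by apply: factor_surj => // x /rE[y <-]; apply: uk => /=.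
by exists v => x; have [y <-] := rS x; rewrite /= vE uE.
Qed.

(** Exactness is the nine lemma; injectivity of [u] uses that of the structure map of Y. A
    functional on C, pulled back and extended to [top] by [dual_onto], kills what comes from
    vertices up to [lo]; its extension to P can be chosen to do so too, hence descends to the
    cokernel for P. *)
Lemma step_coker Z Y C D (p : {linear ev hi Z -> C}) (q : {linear ev hi Y -> D}) :
  step (@fgproj T) Z Y -> dual_onto Z ->
  ses (str hi lo Z) p -> ses (str hi lo Y) q -> step (@fgproj A) C D.
Proof.
move=> [P [a [b [Pp ab /extends_regularP ax]]]] Zd sp sq.
have [E [r sr]] := coker_ses (projective_str_inj (k := lo) (i := hi) Pp.2 (leqnSn i)).
have [_ pS pE] := sp; have [qI qS qE] := sq; have [_ rS rE] := sr.
have [aI bS abE] := evm_ses hi ab; have [_ bSl abEl] := evm_ses lo ab.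
have [u uE] : exists u : {linear C -> E}, forall x, u (p x) = r (evm hi a x).
  apply: (factor_surj (f := r \o evm hi a)) => // x /pE[y <-] /=.
  by apply/rE; exists (evm lo a y); rewrite evm_str.
have [v vE] : exists v : {linear E -> D}, forall x, v (r x) = q (evm hi b x).
  apply: (factor_surj (f := q \o evm hi b)) => // x /rE[y <-] /=.
  by apply/qE; exists (evm lo b y); rewrite evm_str.
exists E, u, v; split; first exact: coker_fgproj sr.
  split=> [|d|x].
  - apply: subker_inj => x; have [y <-] := pS x; rewrite uE => /rE[z zE].
    have /abEl[w wE] : evm lo b z = 0.
      by apply: qI; rewrite -evm_str zE (ses0 (evm_ses hi ab)) linear0.
    by apply/pE; exists w; apply: aI; rewrite evm_str wE zE.
  - by have [x <-] := qS d; have [y <-] := bS x; exists (r y); rewrite vE.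
  - have [y <-] := rS x; rewrite vE; split=> [/qE[z]|[w]].
      have [z' <-] := bSl z; rewrite -evm_str => e.
      have /abE[w wE] : evm hi b (y - str hi lo P z') = 0 by rewrite linearB /= e subrr.
      exists (p w); rewrite uE wE linearB /= (rE (str hi lo P z')).2 ?subr0 //.
      by exists z'.
    have [w' <-] := pS w; rewrite uE -vE => <-.
    by rewrite vE (ses0 (evm_ses hi ab)) linear0.
move=> f; have [g gE] := Zd hi (f \o p).
have [|g' [g'k g'E]] := ax hi g.
  apply: (@kills_succ top lo) => [|x]; first exact: leq_ord.
  have <- : str top hi Z (str hi lo Z x) = str top lo Z x.
    by rewrite str_str /= ?leqnSn.
  by rewrite gE /= (pE _).2 ?linear0 //; exists x.
have [w wE] : exists w : {linear E -> A^o}, forall x, w (r x) = g' (str top hi P x).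
  apply: (factor_surj (f := g' \o str top hi P)) => // x /rE[y <-] /=.
  by rewrite str_str /= ?leqnSn ?leq_ord // g'k.
by exists w => x; have [y <-] := pS x; rewrite uE wE -evm_str g'E gE.
Qed.
End CokernelStep.
End TriangularExtensions.

(** * Gorenstein-projective triangular modules and weakly Gorenstein algebras *)

Section TriangularGorenstein.
Variables (A : pzRingType) (n : nat).
Local Notation T := ('T_n.+1(A)).
Local Notation top := (@ord_max n).
Implicit Types (i j k l : 'I_n.+1) (s t : T) (M N Q C D : lmodType A).
Implicit Types (X Y Z K P : lmodType T).

Lemma Gproj_dual_onto Z : Gproj Z -> dual_onto Z.
Proof.
by move=> /Gproj_stable[_ [K [_ KZ]]]; apply: step_dual_onto KZ => P [].
Qed.

(** Z embeds into a projective module, whose structure maps are injective. *)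
Lemma Gproj_str_inj Z i k : Gproj Z -> (k <= i)%N -> injective (str i k Z).
Proof.
move=> /Gproj_stable[[Y [_ [P [a [b [[_ Pp] ab _]]]]]] _] ki x y e.
have [aI _ _] := evm_ses k ab; apply: aI; apply: (projective_str_inj Pp ki).
by rewrite -!evm_str e.
Qed.

Lemma Gproj_ev Z i : Gproj Z -> Gproj (ev i Z).
Proof.
move=> GZ; pose C M := exists Z, Gproj Z /\ M = ev i Z.
apply: (Gstable_Gproj (C := C)); last by exists Z.
move=> _ [{GZ}Z [GZ ->]]; have [[Y [GY ZY]] [K [GK KZ]]] := Gproj_stable GZ.
have ev_fg P : fgproj P -> fgproj (ev i P).
  by case=> Pf Pp; split; [apply: ev_fin_gen | apply: ev_projective].
split.
  exists (ev i Y); split; first by exists Y.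
  by apply: step_ev ZY _ => //; apply: Gproj_dual_onto.
exists (ev i K); split; first by exists K.
by apply: step_ev KZ _ => //; apply: Gproj_dual_onto.
Qed.

Lemma Gproj_coker Z (i : nat) (h : (i.+1 < n.+1)%N) C
    (p : {linear ev (Ordinal h) Z -> C}) :
  Gproj Z -> ses (str (Ordinal h) (Ordinal (ltnW h)) Z) p -> Gproj C.
Proof.
move=> GZ sp; pose B D := exists Z (p : {linear ev (Ordinal h) Z -> D}),
  Gproj Z /\ ses (str (Ordinal h) (Ordinal (ltnW h)) Z) p.
have inj Y : Gproj Y -> injective (str (Ordinal h) (Ordinal (ltnW h)) Y).
  by move=> GY; apply: Gproj_str_inj => //=; apply: leqnSn.
apply: (Gstable_Gproj (C := B)); last by exists Z, p.
move=> {GZ p sp}{}C [{}Z [p [GZ sp]]].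
have [[Y [GY ZY]] [K [GK KZ]]] := Gproj_stable GZ; split.
  have [D [q sq]] := coker_ses (inj Y GY); exists D; split; first by exists Y, q.
  by apply: step_coker ZY _ sp sq; apply: Gproj_dual_onto.
have [D [q sq]] := coker_ses (inj K GK); exists D; split; first by exists K, q.
by apply: step_coker KZ _ sq sp; apply: Gproj_dual_onto.
Qed.

Lemma vmod_ev (j i : 'I_n.+1) M : (j <= i)%N ->
  exists e : {linear ev i (vmod n j n M) -> M},
    [/\ injective e, surj e & forall x, e x = vco (ev_val x) i].
Proof.
move=> ji; have iI : (j <= i <= n)%N by rewrite ji leq_ord.
have [e eE] := vmod_hom (idfun : {linear vmod n j n M -> vmod n j n M}) iI.
exists e; split=> // [|m].
  apply: subker_inj => x; rewrite eE /= => x0; apply: ev_val_inj.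
  apply: vco_inj => k kI; rewrite -ev_valK vcoZ // vco0 big1 // => l _.
  rewrite ent_tu; case: ifP => [/and3P[_ _ /eqP->]|_]; last by rewrite scale0r.
  by rewrite x0 scaler0.
exists (pr i i (mk_vmod j n (fun=> m))).
by rewrite eE /= vco_tu // vco_mk iI scale1r.
Qed.

Lemma step_vmod j M N : step (@fgproj A) M N ->
  step (@fgproj T) (vmod n j n M) (vmod n j n N).
Proof.
move=> [P [a [b [[Pf Pp] [aI bS abE] ax]]]].
have [a' a'E] := vmod_map n j n a; have [b' b'E] := vmod_map n j n b.
exists (vmod n j n P), a', b'; split.
- by split; [apply: vmod_fin_gen | apply: vmod_projective].
- split=> [|y|x]; [|exact: vmod_map_surj b'E bS y|].
    apply: subker_inj => x x0; apply: vco_inj => k _.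
    by apply: aI; rewrite -a'E x0 !vco0 linear0.
  split=> [x0|[y <-]]; last first.
    by apply: vco_inj => k _; rewrite b'E a'E vco0; apply/abE; exists (vco y k).
  have /choice[y yE] k : exists m, a m = vco x k by apply/abE; rewrite -b'E x0 vco0.
  exists (mk_vmod j n y); apply: vco_inj => k kI.
  by rewrite a'E vco_mk kI yE.
apply/extends_regularP => l g gl.
have [e eE] := vbase_ev j M.
(* Everything at [top] in the interval module comes from vertex j, so [g] amounts to a functional on
   M. *)
have gE x : g x = g (str top j _ (e (vco (ev_val x) top))).
  congr (g _); apply: ev_val_inj; rewrite strE /= eE.
  apply: vco_inj => k kI; have [->|kt] := eqVneq k top.
    by rewrite vco_tu ?leq_ord // scale1r vco_mk eqxx leqnn leq_ord.
  rewrite -ev_valK; transitivity (0 : M); [|apply: esym]; rewrite vcoZ // big1 // => m _;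
    by rewrite ent_tu (negbTE kt) andbF scale0r.
have [d dE] := ax (g \o (str top j _ \o e)).
(* If l > j, then [g] kills what comes from j, that is, everything. If l <= j, the vanishing is
   automatic, the module being 0 below j. *)
case: (leqP l j) => [lj|jl]; last first.
  by exists \0; split=> // x; rewrite gE gl.
have [et [_ _ etE]] := vmod_ev P (leq_ord j : (j <= top)%N).
exists (d \o et); split=> [k kl x|x]; last by rewrite /= etE evmE a'E dE gE.
rewrite /= etE strE /= vco_tu ?leq_ord // vco0E ?scaler0 ?linear0 //.
by rewrite negb_and -ltnNge (leq_trans kl).
Qed.

Lemma Gproj_vmod j M : Gproj M -> Gproj (vmod n j n M).
Proof.
move=> GM; pose C Z := exists M, Gproj M /\ Z = vmod n j n M.
apply: (Gstable_Gproj (C := C)); last by exists M.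
move=> _ [{GM}M [GM ->]]; have [[Y [GY MY]] [K [GK KM]]] := Gproj_stable GM.
split; [exists (vmod n j n Y)|exists (vmod n j n K)]; split.
- by exists Y.
- exact: step_vmod.
- by exists K.
- exact: step_vmod.
Qed.

Lemma Gproj_zero (R : pzRingType) (Z : lmodType R) : (forall x : Z, x = 0) -> Gproj Z.
Proof.
move=> Z0; pose C (X : lmodType R) := forall x : X, x = 0.
apply: (Gstable_Gproj (C := C)) => // {Z0}Z Z0.
suff ZZ : step (@fgproj R) Z Z by split; exists Z.
exists Z, idfun, idfun; split.
- split; first by exists 0%N, (fun=> 0) => x; exists (fun=> 0); rewrite big_ord0.
  by move=> M N g f _; exists \0 => x /=; rewrite [x]Z0 !linear0.
- by split=> // [v|x]; [exists v | split=> // _; exists 0; rewrite [RHS]Z0].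
- by move=> f; exists f.
Qed.

Lemma str_inj Z i k : (forall (m : nat) (h : (m.+1 < n.+1)%N),
    injective (str (Ordinal h) (Ordinal (ltnW h)) Z)) ->
  (k <= i)%N -> injective (str i k Z).
Proof.
move=> inj; case: i => m; elim: m => [|m IH] h; rewrite leq_eqVlt => /orP[/eqP km|km].
- by rewrite (_ : k = Ordinal h) => [x y|]; [rewrite !str_id | apply: val_inj].
- by [].
- by rewrite (_ : k = Ordinal h) => [x y|]; [rewrite !str_id | apply: val_inj].
- move=> x y; have E z : str (Ordinal h) k Z z =
      str (Ordinal h) (Ordinal (ltnW h)) Z (str (Ordinal (ltnW h)) k Z z).
    by rewrite str_str //= leqnSn -ltnS km.
  by rewrite !E => /inj; apply: IH.
Qed.

Lemma pr_tu k l j Z (z : Z) : pr k k (tu 1 l j *: z) = if k == l then pr k j z else 0.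
Proof.
case: eqP => [->|/eqP kl]; apply: ev_val_inj; rewrite /= scalerA.
  by rewrite tu_mull mulr1.
rewrite (_ : _ * _ = 0) ?scale0r //; apply: ent_inj => p q.
rewrite entM ent0 big1 // => m _.
rewrite !ent_tu; case: ifP => [/and3P[_ _ /eqP->]|_]; last by rewrite mul0r.
by rewrite (negbTE kl) andbF mulr0.
Qed.

(* X_j generates a submodule isomorphic to X_j = ... = X_j, supported on the
   vertices j, ..., n; the quotient by it satisfies the same hypotheses from the
   vertex j + 1 on. *)
Lemma Gproj_filtered m (j : nat) Z : (j + m)%N = n.+1 ->
  (forall k, (k < j)%N -> forall x : ev k Z, x = 0) ->
  (forall (i : nat) (h : (i.+1 < n.+1)%N),
    injective (str (Ordinal h) (Ordinal (ltnW h)) Z)) ->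
  (forall (i : nat) (h : (i.+1 < n.+1)%N) C (p : {linear ev (Ordinal h) Z -> C}),
    (j <= i)%N -> ses (str (Ordinal h) (Ordinal (ltnW h)) Z) p -> Gproj C) ->
  (forall h : (j < n.+1)%N, Gproj (ev (Ordinal h) Z)) ->
  Gproj Z.
Proof.
elim: m j Z => [|m IH] j Z jm Z0 inj cok GZj.
  apply: Gproj_zero => z; apply: ev_sep => k.
  by rewrite [LHS]Z0 ?[RHS]Z0 // -[j]addn0 jm.
have hj : (j < n.+1)%N by rewrite -jm -addSnnS leq_addr.
pose J := Ordinal hj; have inj' := str_inj inj.
have [H [HE Hsum]] := vmod_lift (idfun : {linear ev J Z -> ev J Z}).
have prH x k : (J <= k)%N -> pr k k (H x) = str k J Z (vco x k).
  move=> Jk; rewrite Hsum pr_sum (bigD1 k) //= big1 => [|l lk].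
    by rewrite pr_tu eqxx addr0 strE.
  by rewrite pr_tu eq_sym (negbTE lk).
have HI : injective H.
  apply: subker_inj => x x0; apply: vco_inj => k /andP[Jk _]; rewrite vco0.
  by apply: (inj' k J Jk); rewrite -prH // x0 pr0 linear0.
have [Y [q Hq]] := coker_ses HI; have [_ qS qE] := Hq.
have key k (y : ev k Z) : (J <= k)%N -> evm k q y = 0 <-> exists w, str k J Z w = y.
  move=> Jk; split=> [y0|[w <-]].
    have /qE[x xE] : q (ev_val y) = 0 by rewrite -evmE y0.
    by exists (vco x k); rewrite -prH // xE prK.
  have -> : w = pr J J (H (vbase J w)) by rewrite HE prK.
  by rewrite str_pr ?leqnn // evm_pr (ses0 Hq) pr0.
have qSk k : surj (evm k q) by apply: evm_surj.
have Y0 k : (k < j.+1)%N -> forall x : ev k Y, x = 0.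
  move=> kj x; have [y <-] := qSk k x; move: kj; rewrite ltnS leq_eqVlt => /orP[/eqP kj|kj].
    have Jk : (J <= k)%N by rewrite /= kj.
    apply/(key k y Jk); have kJ : J = k by apply: val_inj.
    by case: _ / kJ y Jk {x} => y _; exists y; rewrite str_id.
  by rewrite [y]Z0 // linear0.
apply: (Gproj_ext Hq); first exact/Gproj_vmod/GZj.
have mid (i : nat) (h : (i.+1 < n.+1)%N) w : (j <= i)%N ->
    str (Ordinal h) J Z w =
    str (Ordinal h) (Ordinal (ltnW h)) Z (str (Ordinal (ltnW h)) J Z w).
  by move=> ji; rewrite str_str //= ji leqnSn.
apply: (IH j.+1); first by rewrite addSnnS.
- exact: Y0.
- move=> i h; apply: subker_inj => x; have [ij|ji] := leqP i j.
    by rewrite [x]Y0.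
  have [y <-] := qSk _ x; rewrite -evm_str => /(key (Ordinal h) _ (leqW (ltnW ji)))[w].
  rewrite mid ?(ltnW ji) // => /inj e.
  by apply/(key (Ordinal (ltnW h)) y (ltnW ji)); exists w.
(* Beyond j, both terms are divided by the same copy of the component at j, so the cokernels for Y
   are cokernels for Z. *)
- move=> i h C p /ltnW ji [_ pS pE].
  apply: (cok i h C (p \o evm (Ordinal h) q) ji); split=> [|c|x]; first exact: inj.
    by have [y <-] := pS c; have [x <-] := qSk _ y; exists x.
  split=> /= [/pE[y]|[y <-]]; last by apply/pE; exists (evm _ q y); rewrite evm_str.
  have [z <-] := qSk _ y; rewrite -evm_str => e.
  have /(key (Ordinal h) _ (leqW ji))[w] :
      evm (Ordinal h) q (x - str (Ordinal h) (Ordinal (ltnW h)) Z z) = 0.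
    by rewrite linearB /= e subrr.
  rewrite mid // => wE; exists (str (Ordinal (ltnW h)) J Z w + z).
  by rewrite linearD wE subrK.
(* The first component of Y that may be nonzero, at j + 1, is the cokernel of the structure map of Z
   from j to j + 1. *)
- move=> h; apply: (cok j h _ (evm (Ordinal h) q) (leqnn j)).
  split=> [||x]; [exact: inj|exact: qSk|].
  have -> : Ordinal (ltnW h) = J by apply: val_inj.
  by apply: key; apply: leqnSn.
Qed.

Lemma GprojP Z : Gproj Z <->
  [/\ forall i, Gproj (ev i Z),
      forall (i : nat) (h : (i.+1 < n.+1)%N),
        injective (str (Ordinal h) (Ordinal (ltnW h)) Z)
    & forall (i : nat) (h : (i.+1 < n.+1)%N) C (p : {linear ev (Ordinal h) Z -> C}),
        ses (str (Ordinal h) (Ordinal (ltnW h)) Z) p -> Gproj C].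
Proof.
split=> [GZ|[GZ inj cok]].
  split=> [i|i h|i h C p]; [exact: Gproj_ev| |exact: Gproj_coker].
  by apply: Gproj_str_inj => //=; apply: leqnSn.
by apply: (@Gproj_filtered n.+1 0) => // i h C p _; apply: cok.
Qed.

Lemma weakly_Gorenstein_tri : left_weakly_Gorenstein A -> left_weakly_Gorenstein T.
Proof.
move=> AG Z Zf /semi_GprojP[Zd Zs]; have GZ i : Gproj (ev i Z).
  by apply: AG => //; apply: ev_fin_gen.
have ext (i : nat) (h : (i.+1 < n.+1)%N) :
    extends (str (Ordinal h) (Ordinal (ltnW h)) Z) A^o.
  by move: i h; apply/dual_ontoP.
have inj (i : nat) (h : (i.+1 < n.+1)%N) : injective (str (Ordinal h) (Ordinal (ltnW h)) Z).
  apply: subker_inj => x x0.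
  (* The component embeds into a finitely generated projective, so functionals separate its
     elements. Each functional extends along the structure map, hence kills [x]. *)
  have [[Y [_ [P [a [b [[Pf Pp] [aI _ _] _]]]]]] _] := Gproj_stable (GZ (Ordinal (ltnW h))).
  have [m [g [c cE]]] := fgproj_coord Pf Pp.
  apply: aI; rewrite linear0 [LHS]cE big1 // => s _.
  have [f fE] := ext i h (c s \o a).
  by rewrite -[c s _]/((c s \o a) x) -fE x0 linear0 scale0r.
apply/GprojP; split=> // i h C p sp; have [_ pS _] := sp; apply: AG.
  exact: fin_gen_surj pS (ev_fin_gen _ Zf).
exact: semi_Gproj_coker sp (ext i h) (Zs _) (Zs _).
Qed.

(** The test module is the constant representation M = ... = M: its structure maps are isomorphisms,
    so it is semi-Gorenstein-projective, and M is recovered as a component. *)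
Lemma weakly_Gorenstein_of_tri : left_weakly_Gorenstein T -> left_weakly_Gorenstein A.
Proof.
move=> TG M Mf Ms; pose V := vmod n (ord0 : 'I_n.+1) n M.
have ev_iso i := vmod_ev M (leq0n i : (ord0 : 'I_n.+1) <= i)%N.
have inv i (e : {linear ev i V -> M}) : injective e -> surj e ->
    exists e' : {linear M -> ev i V}, [/\ injective e', surj e' & forall x, e' (e x) = x].
  move=> eI eS; have [e' e'E] := factor_inj (f := (idfun : {linear M -> M})) eI eS.
  have e'K x : e' (e x) = x by apply: eI; rewrite e'E.
  exists e'; split=> // [x y xy|x]; last by exists (e x).
  by rewrite -[x]/(idfun x) -e'E xy e'E.
have GV : Gproj V.
  apply: TG; first exact: vmod_fin_gen.
  apply/semi_GprojP; split=> i; have [e [eI eS eE]] := ev_iso i;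
    have [e' [e'I e'S e'K]] := inv i e eI eS; last exact: semi_Gproj_iso e'I e'S Ms.
  move=> f; have [t [_ _ tE]] := ev_iso top; exists (f \o (e' \o t)) => x /=.
  rewrite (_ : t _ = e x) ?e'K // tE eE.
  by rewrite (vmod_hom_str idfun) ?leq_ord ?leqnn.
have [e [eI eS _]] := ev_iso ord0; have [e' [e'I e'S _]] := inv ord0 e eI eS.
exact: Gproj_iso e'I e'S (Gproj_ev _ GV).
Qed.
End TriangularGorenstein.

(** * Components and structure maps of a module given by a tuple *)

Section TriModuleComponents.
Variables (A : pzRingType) (n : nat) (X : 'I_n.+1 -> lmodType A) (phi : tri_maps X).
Local Notation T := ('T_n.+1(A)).
Local Notation Z := (tri_module phi).
Implicit Types (i j k l : 'I_n.+1) (x : Z).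

Lemma tri_moduleZ (t : T) x j :
  (t *: x) j = \sum_i ent t j i *: phi_comp phi i j (x i).
Proof. by rewrite ffunE. Qed.

Lemma tri_module_tu a j i x k :
  (i <= j)%N -> (tu a j i *: x) k = if k == j then a *: phi_comp phi i k (x i) else 0.
Proof.
move=> ij; rewrite tri_moduleZ (bigD1 i) //= big1 => [|l li].
  by rewrite ent_tu ij eqxx andbT addr0 /=; case: ifP => // _; rewrite scale0r.
by rewrite ent_tu (negbTE li) !andbF scale0r.
Qed.

Lemma tri_module_ev k : exists e : {linear ev k Z -> X k},
  [/\ injective e, surj e & forall x : ev k Z, e x = (ev_val x : Z) k].
Proof.
have eL : linear (fun x : ev k Z => (ev_val x : Z) k).
  move=> a x y; rewrite ev_valD ev_valZ tri_moduleD tri_module_tu // eqxx.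
  by rewrite phi_comp_id.
have [e eE] := linear_of eL; exists e; split=> // [|v].
  apply: subker_inj => x; rewrite eE => x0; apply: ev_val_inj; rewrite -ev_valK.
  apply/ffunP => l; rewrite tri_module_tu // x0 linear0 scaler0 if_same.
  by rewrite ffunE.
(* Any tuple with entry [v] at k would serve; [phi_comp] provides one, as it gives an element of
   each [X l] and is the identity at k. *)
exists (pr k k (finfun (fun l => phi_comp phi k l v) : Z)).
by rewrite eE /= tri_module_tu // eqxx scale1r ffunE !phi_comp_id.
Qed.

Lemma tri_module_str (i : nat) (h : (i.+1 < n.+1)%N)
    (x : ev (Ordinal (ltnW h)) Z) :
  (ev_val (str (Ordinal h) (Ordinal (ltnW h)) Z x) : Z) (Ordinal h) =
  phi h ((ev_val x : Z) (Ordinal (ltnW h))).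
Proof.
rewrite strE /= tri_module_tu ?leqnSn // eqxx scale1r.
have ne : Ordinal (ltnW h) != Ordinal h by rewrite -val_eqE /= neq_ltn ltnSn.
by rewrite (phi_compS phi ne); congr (phi h _); apply: phi_comp_id.
Qed.

Lemma tri_module_components : exists e : forall k, {linear ev k Z -> X k},
  [/\ forall k, injective (e k), forall k, surj (e k)
    & forall (i : nat) (h : (i.+1 < n.+1)%N) (x : ev (Ordinal (ltnW h)) Z),
        e (Ordinal h) (str (Ordinal h) (Ordinal (ltnW h)) Z x) =
        phi h (e (Ordinal (ltnW h)) x)].
Proof.
have [e eE] := dep_choice tri_module_ev; exists e; split=> [k|k|i h x].
- by case: (eE k).
- by case: (eE k).
- have [_ _ ->] := eE (Ordinal h); have [_ _ ->] := eE (Ordinal (ltnW h)).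
  exact: tri_module_str.
Qed.
End TriModuleComponents.

(** * Transport of the conditions along isomorphic maps *)

Section Transport.
Variable R : pzRingType.
Implicit Types U V X Y C : lmodType R.

Lemma linear_inverse U X (e : {linear U -> X}) : injective e -> surj e ->
  exists d : {linear X -> U}, [/\ injective d, surj d, cancel d e & cancel e d].
Proof.
move=> eI eS; have [d dE] := factor_inj (f := (idfun : {linear X -> X})) eI eS.
have dK : cancel d e by move=> x; rewrite dE.
have eK : cancel e d by move=> x; apply: eI; rewrite dK.
by exists d; split=> //; [apply: can_inj dK | move=> x; exists (e x)].
Qed.

Section Square.
Variables (U V X Y : lmodType R) (f : {linear U -> V}) (g : {linear X -> Y}).
Variables (eU : {linear U -> X}) (eV : {linear V -> Y}).
Hypotheses (eUI : injective eU) (eUS : surj eU) (eVI : injective eV) (eVS : surj eV).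
Hypothesis fg : forall u, eV (f u) = g (eU u).

Lemma square_injective : injective f <-> injective g.
Proof.
split=> [fI x y|gI u v e]; last by apply/eUI/gI; rewrite -!fg e.
have [u <-] := eUS x; have [v <-] := eUS y.
by rewrite -!fg => /eVI/fI ->.
Qed.

Lemma square_extends Q : extends f Q <-> extends g Q.
Proof.
have [dU [_ _ dUK eUK]] := linear_inverse eUI eUS.
have [dV [_ _ dVK eVK]] := linear_inverse eVI eVS.
split=> [fx h|gx h].
  have [k kE] := fx (h \o eU); exists (k \o dV) => x /=.
  by have [u <-] := eUS x; rewrite -fg eVK kE.
have [k kE] := gx (h \o dU); exists (k \o eV) => u.
by rewrite /= fg kE /= eUK.
Qed.

(** Links the condition on all cokernels of [f], given by short exact sequences, with the one
    concrete quotient [coker g]; any two cokernels are isomorphic. *)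
Lemma square_coker : injective f ->
  (forall C (p : {linear V -> C}), ses f p -> Gproj C) <-> Gproj (coker g).
Proof.
move=> fI; have [q [qS qE]] := cokerP g.
have qf u : q (eV (f u)) = 0 by apply/qE; exists (eU u); rewrite fg.
have qf0 v : q (eV v) = 0 <-> exists u, f u = v.
  split=> [/qE[x]|[u <-]] //; have [u <-] := eUS x.
  by rewrite -fg => /eVI <-; exists u.
split=> [h|Gg C p [_ pS pE]].
  apply: (h _ (q \o eV)); split=> // y; have [z <-] := qS y.
  by have [v <-] := eVS z; exists v.
have [d dE] : exists d : {linear C -> coker g}, forall v, d (p v) = q (eV v).
  by apply: (factor_surj (f := q \o eV)) => // v /pE[u <-]; apply: qf.
apply: Gproj_iso (d) _ _ Gg => [|y].
  by apply: subker_inj => c; have [v <-] := pS c; rewrite dE => /qf0/pE.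
by have [z <-] := qS y; have [v <-] := eVS z; exists (p v); rewrite dE.
Qed.
End Square.
End Transport.

Unset Implicit Arguments.

Theorem corollary1p7 (A : pzRingType) (hA : artin_algebra A)
    (n : nat) (hn : (2 <= n)%N) :
  [/\ (forall (X : 'I_n -> lmodType A) (phi : tri_maps X),
        (forall i, fin_gen (X i)) ->
        (semi_Gproj (tri_module phi) <->
          (forall (i : nat) (h : (i.+1 < n)%N), dual_epi (phi i h)) /\
          (forall i, semi_Gproj (X i)))),
      (forall (X : 'I_n -> lmodType A) (phi : tri_maps X),
        (forall i, fin_gen (X i)) ->
        (Gproj (tri_module phi) <->
          [/\ forall i, Gproj (X i),
              forall (i : nat) (h : (i.+1 < n)%N), injective (phi i h)
            & forall (i : nat) (h : (i.+1 < n)%N), Gproj (coker (phi i h))]))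
    & left_weakly_Gorenstein 'T_n(A) <-> left_weakly_Gorenstein A].
Proof.
case: n hn => // n _; split; last first.
- by split=> [|AG]; [apply: weakly_Gorenstein_of_tri | apply: weakly_Gorenstein_tri].
- move=> X phi _; rewrite GprojP.
  have [e [eI eS sq]] := tri_module_components phi.
  have GE k : Gproj (ev k (tri_module phi)) <-> Gproj (X k).
    have [d [dI dS _ _]] := linear_inverse (eI k) (eS k).
    by split; apply: Gproj_iso; [exact: dI | exact: dS | exact: eI | exact: eS].
  have inj i h := square_injective (@eI _) (@eS _) (@eI _) (sq i h).
  have cok i h := square_coker (@eS _) (@eI _) (@eS _) (sq i h).
  split=> -[G1 G2 G3]; split=> [i|i h|i h]; try exact/GE.
  + exact: (inj i h).1 (G2 i h).
  + by apply/(cok i h (G2 i h)) => C p; apply: G3.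
  + exact: (inj i h).2 (G2 i h).
  + exact/(cok i h ((inj i h).2 (G2 i h))).
- move=> X phi _; rewrite semi_GprojP dual_ontoP.
  have [e [eI eS sq]] := tri_module_components phi.
  have sE k : semi_Gproj (ev k (tri_module phi)) <-> semi_Gproj (X k).
    have [d [dI dS _ _]] := linear_inverse (eI k) (eS k).
    by split; apply: semi_Gproj_iso; [exact: eI | exact: eS | exact: dI | exact: dS].
  have ext i h := square_extends (@eI _) (@eS _) (@eI _) (@eS _) (sq i h) A^o.
  split=> -[x s]; split=> [i h|i]; try exact/sE.
    by move=> f; have /ext/(_ f)[g gE] := x i h; exists g.
  by apply/ext => f; have [g gE] := x i h f; exists g.
Qed.
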